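(* Let $k\ge 1$ be an odd integer and let $\Phi$ be the standard normal c.d.f. Then there is no distribution matching $k$ even normal moments that maximizes the difference $|F(0)-\Phi(0)|$ from the normal c.d.f. at zero among all distributions (with c.d.f. $F$) matching $k$ even normal moments. In fact, the supremum of this difference over distributions matching $k$ even normal moments equals the maximal value of the difference over distributions matching $k-1$ even normal moments, and it is the limit of the differences $|F_m(0)-\Phi(0)|$ along a sequence of discrete mixtures $F_m$ matching $k$ even normal moments whose maximal mass point tends to $\infty$ as $m\to\infty$.
   Context: A distribution on $\mathbb{R}$ (of a random variable $X$) matches $k$ even normal moments if $E X^{j}=E Z^j$ for all $j=1,\dots,2k$, where $Z\sim N(0,1)$; that is, the even moments of orders $2,4,\dots,2k$ are matched and the odd moments up to order $2k-1$ vanish, as they do for symmetric distributions (for $k=0$ there is no condition). A discrete mixture here is a symmetric probability distribution with finitely many mass points: for some $0<y_1<\dots<y_n$ it has equal positive masses at $y_j$ and $-y_j$ for each $j$, and the remaining mass at zero; its maximal mass point is $y_n$. The c.d.f. is $F(t)=P(X\le t)$. *)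

(* Defs.v *)
From HB Require Import structures.
From mathcomp Require Import all_boot all_order all_algebra.
From mathcomp Require Import all_classical all_reals all_analysis.

Set Implicit Arguments.
Unset Strict Implicit.
Unset Printing Implicit Defensive.

Import Order.TTheory GRing.Theory Num.Theory.
Import numFieldNormedType.Exports.

Local Open Scope classical_set_scope.
Local Open Scope ring_scope.

(* A distribution on the real line is a Borel probability measure; the identity
   is a random variable having that distribution. *)
Definition distr (R : realType) := probability (measurableTypeR R) R.

Definition idR (R : realType) : measurableTypeR R -> R := idfun.

HB.instance Definition _ (R : realType) :=
  @isMeasurableFun.Build _ _ _ _ (@idR R) (@measurable_id _ _ setT).

Definition dcdf (R : realType) (mu : distr R) (t : R) : \bar R :=
  cdf (@idR R : {RV mu >-> R}) t.

(* The second parameter of normal_prob is the standard deviation. *)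
Definition std_normal (R : realType) : distr R := normal_prob (0 : R) 1.

(* Integrability makes explicit that each moment exists. *)
Definition matches_moments (R : realType) (k : nat) (mu : distr R) : Prop :=
  forall j : nat, (1 <= j <= k.*2)%N ->
    mu.-integrable [set: measurableTypeR R] (fun x : R => (x ^+ j)%:E) /\
    ('E_mu[(fun x : R => x ^+ j)%R] =
      'E_(std_normal R)[(fun x : R => x ^+ j)%R])%E.

Definition gap0 (R : realType) (mu : distr R) : \bar R :=
  (`| dcdf mu 0%R - dcdf (std_normal R) 0%R |)%E.

(* The points y_1 < ... < y_n are indexed from 0 by 'I_n.+1, so that the family
   is nonempty and its maximal element is y ord_max. The mass at zero, which may
   vanish, is all the mass not carried by the points y i and - y i. *)
Definition discrete_mixture (R : realType) (mu : distr R) (ymax : R) : Prop :=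
  exists (n : nat) (y : 'I_n.+1 -> R),
    [/\ forall i, 0 < y i,
        forall i j : 'I_n.+1, (i < j)%N -> y i < y j,
        forall i, (0 < mu [set y i])%E /\ mu [set - y i] = mu [set y i],
        (mu [set 0%R] =
            1 - \sum_(i < n.+1) (mu [set y i] + mu [set (- y i)%R]))%E
      & ymax = y ord_max].

(* Main.v *)
(* Let p_n be the orthogonal polynomials of N(0,1), with squared norms h_n, and let
   l = 1 / sum_(j < k) p_j(0)^2 / h_j be the Christoffel number at 0. As k is odd,
   0 is a root of p_k, so the k-point Gauss rule is a symmetric distribution that
   matches the moments up to 2k - 2 and has mass l at 0; its gap is l / 2.
   Conversely (Markov, Stieltjes) there is a polynomial P of degree at most 2k - 2
   with P >= 1_(x <= 0) and, when k > 1, equality exactly at the nodes; hence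
   F(0) <= E P(X) = E P(Z) = (1 + l) / 2, and P(- x) gives the lower bound. If k even
   moments are matched and the bound is attained, then X is supported on the nodes,
   so that E p_k(X)^2 = 0, whereas E p_k(X)^2 = E p_k(Z)^2 > 0. Finally, replacing
   the last recurrence coefficient b_k by a large B in x p_(k+1) - b_k p_k yields
   (k+2)-point Gauss rules that still match the moments up to 2k; as B grows their
   largest node goes to infinity, and their mass at 0 goes to l since p_k(0) = 0. *)

From HB Require Import structures.
Require Import Defs.
From mathcomp Require Import all_boot all_order all_algebra.
From mathcomp Require Import all_classical all_reals all_analysis.
From mathcomp Require Import measurable_realfun complex polyrcf ring lra.

Set Implicit Arguments.
Unset Strict Implicit.
Unset Printing Implicit Defensive.

Import Order.TTheory GRing.Theory Num.Theory.
Import numFieldNormedType.Exports.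
Import HBNNSimple.

Local Open Scope classical_set_scope.
Local Open Scope ring_scope.


(** * Orthogonal polynomials and Gauss quadrature *)

Section ThreeTermRecurrence.

Variable F : comNzRingType.
Implicit Types (b : nat -> F) (n : nat).

(** Carrying two consecutive polynomials makes the two-step recurrence structural. There is no
    diagonal coefficient, as for a symmetric distribution, so [opoly b n] has the parity of [n]. *)
Fixpoint opoly_pair b n : {poly F} * {poly F} :=
  if n is n'.+1 then
    ((opoly_pair b n').2, 'X * (opoly_pair b n').2 - (b n')%:P * (opoly_pair b n').1)
  else (1, 'X).

Definition opoly b n := (opoly_pair b n).1.

(** The squared norm of [opoly b n] for the functional of total mass 1 that makes these polynomials
    orthogonal. *)
Definition opnorm b n := \prod_(i < n) b i.

Lemma opolySS b n : opoly b n.+2 = 'X * opoly b n.+1 - (b n)%:P * opoly b n.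
Proof. by []. Qed.

Lemma opnorm0 b : opnorm b 0 = 1.
Proof. by rewrite /opnorm big_ord0. Qed.

Lemma opnormS b n : opnorm b n.+1 = opnorm b n * b n.
Proof. by rewrite /opnorm big_ord_recr. Qed.

Lemma opnorm_eq b c n : (forall i, (i < n)%N -> b i = c i) -> opnorm b n = opnorm c n.
Proof. by move=> bc; apply: eq_bigr => i _; rewrite bc. Qed.

Lemma opoly_monic_size b n : opoly b n \is monic /\ size (opoly b n) = n.+1.
Proof.
suff : [/\ opoly b n \is monic, size (opoly b n) = n.+1,
           opoly b n.+1 \is monic & size (opoly b n.+1) = n.+2] by case.
elim: n => [|n [m0 s0 m1 s1]].
  by rewrite /opoly /= monic1 size_poly1 monicX size_polyX.
have s2 : size ('X * opoly b n.+1) = n.+3.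
  by rewrite mulrC size_mulX ?monic_neq0// s1.
have lt2 : (size (- ((b n)%:P * opoly b n)) < size ('X * opoly b n.+1)%R)%N.
  rewrite s2 size_polyN mul_polyC (leq_ltn_trans (size_scale_leq _ _))// s0.
  by rewrite ltnS leqnSn.
split=> //; rewrite opolySS.
  by rewrite monicE lead_coefDl// -monicE monicMl// monicX.
by rewrite size_polyDl.
Qed.

Lemma opoly_monic b n : opoly b n \is monic.
Proof. by case: (opoly_monic_size b n). Qed.

Lemma size_opoly b n : size (opoly b n) = n.+1.
Proof. by case: (opoly_monic_size b n). Qed.

(** Only the coefficients up to index [n - 2] enter [opoly b n], while [opnorm b n] also involves
    index [n - 1]. Changing [b k] alone thus keeps the polynomials up to degree [k + 1] and the
    norms up to index [k]. *)
Lemma opoly_eq b c n : (forall i, (i.+1 < n)%N -> b i = c i) -> opoly b n = opoly c n.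
Proof.
suff H m : (forall i, (i.+1 < m.+1)%N -> b i = c i) ->
    opoly b m = opoly c m /\ opoly b m.+1 = opoly c m.+1.
  case: n => [//|n bc]; exact: (H n bc).2.
elim: m => [//|m IH bc].
have [|e1 e2] := IH; first by move=> i im; apply: bc; exact: ltnW.
by rewrite !opolySS e1 e2 bc.
Qed.

Lemma horner_opolySS b n x :
  (opoly b n.+2).[x] = x * (opoly b n.+1).[x] - b n * (opoly b n).[x].
Proof. by rewrite opolySS !hornerE. Qed.

Lemma horner_opolyN b n x : (opoly b n).[- x] = (-1) ^+ n * (opoly b n).[x].
Proof.
suff : (opoly b n).[- x] = (-1) ^+ n * (opoly b n).[x] /\
       (opoly b n.+1).[- x] = (-1) ^+ n.+1 * (opoly b n.+1).[x] by case.
elim: n => [|n [e0 e1]]; first by rewrite /opoly /= !hornerE; split; ring.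
by split=> //; rewrite !horner_opolySS e0 e1 !exprS; ring.
Qed.

End ThreeTermRecurrence.


Lemma map_opoly (F G : comNzRingType) (f : {rmorphism F -> G}) b n :
  map_poly f (opoly b n) = opoly (f \o b) n.
Proof.
suff : map_poly f (opoly b n) = opoly (f \o b) n /\
       map_poly f (opoly b n.+1) = opoly (f \o b) n.+1 by case.
elim: n => [|n [e0 e1]]; first by rewrite /opoly /= rmorph1 map_polyX.
by split=> //; rewrite !opolySS rmorphB !rmorphM/= map_polyX map_polyC e0 e1.
Qed.

(* [g] stands for the inverses of the squared norms [opnorm b]; this form of the
   identity has no division and also applies to polynomials in [x]. *)
Lemma christoffel_darboux (F : comNzRingType) (b g u v : nat -> F) (x y : F) n :
  (forall i, b i * g i.+1 = g i) ->
  u 0%N = 1 -> u 1%N = x -> (forall i, u i.+2 = x * u i.+1 - b i * u i) ->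
  v 0%N = 1 -> v 1%N = y -> (forall i, v i.+2 = y * v i.+1 - b i * v i) ->
  (x - y) * \sum_(j < n.+1) u j * v j * g j
  = (u n.+1 * v n - u n * v n.+1) * g n.
Proof.
move=> bg u0 u1 uSS v0 v1 vSS; elim: n => [|n IH].
  by rewrite big_ord1 u0 v0 u1 v1 /=; ring.
by rewrite big_ord_recr/= mulrDr IH uSS vSS -bg; ring.
Qed.

(** * Reality and simplicity of the roots *)

Section RealRoots.

Variables (R : rcfType) (b : nat -> R).
Hypothesis b_gt0 : forall i, 0 < b i.

Lemma opnorm_gt0 n : 0 < opnorm b n.
Proof. by apply: prodr_gt0. Qed.

Let opnormVS i : b i * (opnorm b i.+1)^-1 = (opnorm b i)^-1.
Proof. by rewrite opnormS invfM mulrCA divff ?mulr1// gt_eqF. Qed.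

Lemma christoffel_darboux_opoly x y n :
  (x - y) * \sum_(j < n.+1) (opoly b j).[x] * (opoly b j).[y] / opnorm b j
  = ((opoly b n.+1).[x] * (opoly b n).[y] - (opoly b n).[x] * (opoly b n.+1).[y])
    / opnorm b n.
Proof.
apply: (@christoffel_darboux _ b (fun j => (opnorm b j)^-1)
  (fun j => (opoly b j).[x]) (fun j => (opoly b j).[y])) => //;
  by [move=> i; exact: horner_opolySS | rewrite /opoly /= ?hornerX ?hornerC].
Qed.

Lemma opoly_kernel_gt0 x n : 0 < \sum_(j < n.+1) (opoly b j).[x] ^+ 2 / opnorm b j.
Proof.
rewrite big_ord_recl/= opnorm0 /opoly /= hornerC expr1n divr1.
by rewrite ltr_wpDr// sumr_ge0// => j _; rewrite divr_ge0 ?sqr_ge0// ltW ?opnorm_gt0.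
Qed.

Local Notation C := (real_complex R).

(** In the Christoffel-Darboux identity at a root [z] and its conjugate the right side vanishes,
    while the kernel sum is positive; hence [z] equals its conjugate. *)
Lemma opoly_complex_root_real n z : root (map_poly C (opoly b n)) z -> z \is Num.real.
Proof.
case: n => [|n]; first by rewrite /opoly /= rmorph1 (negPf (root1 _)).
rewrite map_opoly => pz.
pose K := \sum_(j < n.+1)
  (opoly (C \o b) j).[z] * ((opoly (C \o b) j).[z])^* * C (opnorm b j)^-1.
have K_gt0 : 0 < K.
  rewrite /K big_ord_recl/= opnorm0 /opoly /= hornerC rmorph1 !mul1r invr1 rmorph1.
  rewrite ltr_wpDr// sumr_ge0// => j _; rewrite mulr_ge0 ?mul_conjC_ge0//.
  by rewrite lecR invr_ge0 ltW ?opnorm_gt0.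
have conj_opoly j : ((opoly (C \o b) j).[z])^* = (opoly (C \o b) j).[z^*].
  rewrite -horner_map /= map_opoly; congr (_.[_]).
  apply: opoly_eq => i _ /=; apply: conj_Creal.
  by rewrite ger0_real// lecR ltW.
have : (z - z^*) * K = 0.
  rewrite (@christoffel_darboux _ (C \o b) (fun j => C (opnorm b j)^-1)
    (fun j => (opoly (C \o b) j).[z]) (fun j => ((opoly (C \o b) j).[z])^*)) /=.
  - by rewrite (rootP pz) conj_opoly rmorph0 mulr0 mul0r subr0 mul0r.
  - by move=> i; rewrite -rmorphM/= opnormVS.
  - by rewrite /opoly /= hornerC.
  - by rewrite /opoly /= hornerX.
  - by move=> i; rewrite horner_opolySS.
  - by rewrite /opoly /= hornerC rmorph1.
  - by rewrite conj_opoly /opoly /= hornerX.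
  - by move=> i; rewrite !conj_opoly horner_opolySS.
move/eqP; rewrite mulf_eq0 (gt_eqF K_gt0) orbF subr_eq0 => /eqP zz.
by apply/CrealP.
Qed.

Lemma opoly_real_roots n :
  exists s : seq R, size s = n /\ opoly b n = \prod_(x <- s) ('X - x%:P).
Proof.
have [rs prs] := closed_field_poly_normal (map_poly C (opoly b n)).
have rs_real z : z \in rs -> C (complex.Re z) = z.
  move=> zrs; apply: RRe_real; apply: (@opoly_complex_root_real n).
  by rewrite prs rootZ ?root_prod_XsubC// lead_coef_map fmorph_eq0
    (monicP (opoly_monic _ _)) oner_eq0.
exists (map (@complex.Re R) rs).
have e : opoly b n = \prod_(x <- map (@complex.Re R) rs) ('X - x%:P).
  apply: (map_poly_inj C); rewrite prs lead_coef_map.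
  rewrite (monicP (opoly_monic _ _)) rmorph1 scale1r rmorph_prod big_map.
  rewrite big_seq [RHS]big_seq; apply: eq_bigr => z zrs.
  by rewrite /= map_polyXsubC/= rs_real.
split=> //; apply/eqP; rewrite -eqSS -(size_opoly b n) e size_prod_XsubC.
by rewrite size_map.
Qed.

(** At a double root [x], Christoffel-Darboux with the indeterminate as first variable can be
    divided by ['X - x%:P]. Evaluated at [x], it then says that the positive kernel sum at [x] is
    0. *)
Lemma opoly_roots_uniq n (s : seq R) :
  opoly b n = \prod_(x <- s) ('X - x%:P) -> uniq s.
Proof.
case: n => [|n] ps.
  have := size_opoly b 0; rewrite ps size_prod_XsubC.
  by case: s {ps}.
apply: count_mem_uniq => x; case: (boolP (x \in s)) => [xs|/count_memPn//].
rewrite (permP (perm_to_rem xs)) /= eqxx.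
have -> : count_mem x (rem x s) = 0%N; last by [].
apply/count_memPn/negP => xt.
pose q : {poly R} := \prod_(y <- rem x s) ('X - y%:P).
have pq : opoly b n.+1 = ('X - x%:P) * q.
  by rewrite ps (perm_big _ (perm_to_rem xs)) big_cons.
have qx : q.[x] = 0 by apply/rootP; rewrite root_prod_XsubC.
have := @christoffel_darboux _ (fun i => (b i)%:P) (fun j => ((opnorm b j)^-1)%:P)
    (fun j => opoly b j) (fun j => ((opoly b j).[x])%:P) 'X x%:P n.
rewrite pq !hornerE subrr mul0r mulr0 subr0 -!mulrA => K.
have {}K := mulfI (negbT (polyXsubC_eq0 x)) (K _ _ _ _ _ _ _).
have K0 : \sum_(j < n.+1) (opoly b j).[x] ^+ 2 / opnorm b j = 0.
  transitivity (\sum_(j < n.+1)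
      opoly b j * ((opoly b j).[x])%:P * ((opnorm b j)^-1)%:P).[x].
    by rewrite horner_sum; apply: eq_bigr => j _; rewrite !hornerE expr2.
  rewrite K ?hornerM ?qx ?mul0r// => i.
  - by rewrite -polyCM opnormVS.
  - by rewrite horner_opolySS polyCB !polyCM.
by have := opoly_kernel_gt0 x n; rewrite K0 ltxx.
Qed.

Lemma opoly_sorted_roots n : exists s : seq R,
  [/\ size s = n, sorted <%R s & opoly b n = \prod_(x <- s) ('X - x%:P)].
Proof.
have [s [sn ps]] := opoly_real_roots n.
exists (sort <=%R s); split.
- by rewrite size_sort.
- by rewrite lt_sorted_uniq_le sort_uniq (opoly_roots_uniq ps) sort_le_sorted.
- by rewrite ps; apply: perm_big; rewrite perm_sym perm_sort.
Qed.

End RealRoots.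

(** * Gauss weights *)

Section GaussQuadrature.

Variables (R : rcfType) (b : nat -> R).
Hypothesis b_gt0 : forall i, 0 < b i.

(** At a root [x] of [opoly b n], this is the Christoffel number of the node [x] in the [n]-point
    Gauss rule. *)
Definition gauss_weight n (x : R) :=
  (\sum_(j < n) (opoly b j).[x] ^+ 2 / opnorm b j)^-1.

Lemma gauss_weight_gt0 n x : 0 < gauss_weight n.+1 x.
Proof. by rewrite invr_gt0 opoly_kernel_gt0. Qed.

Lemma gauss_weightN n x : gauss_weight n (- x) = gauss_weight n x.
Proof.
congr _^-1; apply: eq_bigr => j _.
by rewrite horner_opolyN exprMn sqrr_sign mul1r.
Qed.

(* The Christoffel-Darboux identity says that the rows of the matrix with
   entries [p_j(x_i)], suitably normalized, are orthogonal; hence so are its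
   columns. *)
Lemma gauss_orthogonal n (s : seq R) i j :
  opoly b n = \prod_(x <- s) ('X - x%:P) -> (i < n)%N -> (j < n)%N ->
  \sum_(x <- s) gauss_weight n x * ((opoly b i).[x] * (opoly b j).[x])
  = (i == j)%:R * opnorm b i.
Proof.
case: n => // n ps lti ltj.
have us : uniq s := opoly_roots_uniq b_gt0 ps.
have ss : size s = n.+1.
  by apply/eqP; rewrite -eqSS -(size_opoly b n.+1) ps size_prod_XsubC.
pose x (k : 'I_n.+1) := nth 0 s k.
have px k : (opoly b n.+1).[x k] = 0.
  by apply/rootP; rewrite ps root_prod_XsubC mem_nth ?ss.
pose A := \matrix_(k < n.+1, l < n.+1) (gauss_weight n.+1 (x k) * (opoly b l).[x k]).
pose B := \matrix_(l < n.+1, k < n.+1) ((opoly b l).[x k] / opnorm b l).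
have AB : A *m B = 1%:M.
  apply/matrixP => k k'; rewrite !mxE.
  have -> : \sum_l A k l * B l k' = gauss_weight n.+1 (x k) *
      \sum_(l < n.+1) (opoly b l).[x k] * (opoly b l).[x k'] / opnorm b l.
    by rewrite mulr_sumr; apply: eq_bigr => l _; rewrite !mxE !mulrA.
  have [->|kk'] := eqVneq k k'.
    rewrite mulr1n /gauss_weight.
    under [X in _ * X]eq_bigr do rewrite -expr2.
    by rewrite mulVf// gt_eqF// opoly_kernel_gt0.
  have xkk' : x k - x k' != 0.
    by rewrite subr_eq0 nth_uniq ?ss.
  have := christoffel_darboux_opoly b_gt0 (x k) (x k') n.
  rewrite !px mul0r mulr0 subrr mul0r => /eqP.
  by rewrite mulf_eq0 (negPf xkk') /= => /eqP ->; rewrite mulr0.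
have /matrixP/(_ (Ordinal lti) (Ordinal ltj)) := mulmx1C AB.
rewrite !mxE/= => e.
have -> : (i == j)%:R = (Ordinal lti == Ordinal ltj)%:R :> R by [].
rewrite -e mulr_suml (big_nth 0) big_mkord ss; apply: eq_bigr => k _.
by rewrite !mxE/= -/(x k); field; rewrite gt_eqF// opnorm_gt0.
Qed.

End GaussQuadrature.

(** The products [opoly b i * opoly b j] with [i] and [j] at most [d] are monic and reach every
    degree up to [2d], so the leading term of [q] can be removed repeatedly. Applied to a difference
    of two functionals, this turns common orthogonality relations into equality of moments. *)
Lemma functional_eq0 (R : fieldType) (b : nat -> R) (L : {poly R} -> R) d
  (q : {poly R}) :
  (forall a p r, L (a *: p + r) = a * L p + L r) ->
  (forall i j, (i <= d)%N -> (j <= d)%N -> L (opoly b i * opoly b j) = 0) ->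
  (size q <= d.*2.+1)%N -> L q = 0.
Proof.
move=> Llin L0; have L00 : L 0 = 0.
  have := Llin 1 0 0; rewrite scaler0 addr0 mul1r => /eqP.
  by rewrite -subr_eq subrr eq_sym => /eqP.
have [m] := ubnP (size q); elim: m q => // m IH q.
rewrite ltnS => qm qd.
have [->//|q0] := eqVneq q 0.
have sq : (0 < size q)%N by rewrite size_poly_gt0.
pose j := minn d (size q).-1; pose i := ((size q).-1 - j)%N.
have jd : (j <= d)%N by rewrite geq_minl.
have ij : (i + j = (size q).-1)%N by rewrite subnK// geq_minr.
have id : (i <= d)%N.
  rewrite /i /j; move: qd; rewrite -(prednK sq) ltnS -addnn /=.
  by case: (leqP d (size q).-1) => h; rewrite ?subnn// leq_subLR.
pose t := opoly b i * opoly b j.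
have mt : t \is monic by rewrite monicMl opoly_monic.
have st : size t = size q.
  rewrite size_monicM ?opoly_monic ?monic_neq0 ?opoly_monic//.
  by rewrite !size_opoly addnS addSn ij !prednK.
have -> : q = lead_coef q *: t + (q - lead_coef q *: t) by rewrite addrC subrK.
rewrite Llin L0// mulr0 add0r.
have lt : (size (q - lead_coef q *: t)%R < size q)%N.
  rewrite -(prednK sq) ltnS; apply/leq_sizeP => l; rewrite coefB coefZ.
  rewrite leq_eqVlt => /predU1P[<-|].
    by rewrite -{2}st -!lead_coefE (monicP mt) mulr1 subrr.
  by rewrite prednK// => ql; rewrite !nth_default ?st// mulr0 subrr.
by apply: IH; [exact: leq_trans lt qm | exact: leq_trans (ltnW lt) qd].
Qed.

(** * The recurrence of a symmetric positive functional *)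

Section OrthogonalPolynomials.

Variables (R : numFieldType) (L : {poly R} -> R).
Hypothesis L_lin : forall a p q, L (a *: p + q) = a * L p + L q.
Hypothesis L1 : L 1 = 1.
Hypothesis L_sqr_gt0 : forall p, p != 0 -> 0 < L (p ^+ 2).
Hypothesis L_sym : forall p, L (p \Po - 'X) = L p.

(** Each coefficient is a ratio of squared norms of polynomials already built (the Stieltjes
    procedure), so both are constructed together; [opoly_pairE] then identifies the result with
    [opoly_pair] for these coefficients. *)
Fixpoint lopoly_pair n : {poly R} * {poly R} :=
  if n is n'.+1 then
    let pq := lopoly_pair n' in
    (pq.2, 'X * pq.2 - (L (pq.2 ^+ 2) / L (pq.1 ^+ 2))%:P * pq.1)
  else (1, 'X).

Definition recurrence_coef n := L ((lopoly_pair n).2 ^+ 2) / L ((lopoly_pair n).1 ^+ 2).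

Local Notation b := recurrence_coef.

Let opoly_pairE n : opoly_pair b n = lopoly_pair n.
Proof. by elim: n => //= n ->. Qed.

Let LB p q : L (p - q) = L p - L q.
Proof. by rewrite addrC -scaleN1r L_lin mulN1r addrC. Qed.

Let LZ a p : L (a *: p) = a * L p.
Proof.
have L0 : L 0 = 0 by rewrite -(subrr 0) LB subrr.
by rewrite -[a *: p]addr0 L_lin L0 addr0.
Qed.

Let bE n : b n = L (opoly b n.+1 ^+ 2) / L (opoly b n ^+ 2).
Proof. by rewrite /opoly /= opoly_pairE. Qed.

Let Lop_gt0 n : 0 < L (opoly b n ^+ 2).
Proof. by apply: L_sqr_gt0; rewrite monic_neq0// opoly_monic. Qed.

Lemma recurrence_coef_gt0 n : 0 < b n.
Proof. by rewrite bE divr_gt0. Qed.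

Let Lop_sqr n : L (opoly b n ^+ 2) = opnorm b n.
Proof.
elim: n => [|n IH]; first by rewrite opnorm0 /opoly /= expr1n.
by rewrite opnormS bE -IH mulrC divfK// gt_eqF.
Qed.

Let opoly_comp_oppX n : opoly b n \Po - 'X = (-1) ^+ n *: opoly b n.
Proof.
suff : opoly b n \Po - 'X = (-1) ^+ n *: opoly b n /\
       opoly b n.+1 \Po - 'X = (-1) ^+ n.+1 *: opoly b n.+1 by case.
elim: n => [|n [e0 e1]].
  by rewrite /opoly /= comp_polyC comp_polyX expr1 scaleN1r scale1r.
split=> //; rewrite opolySS comp_polyB !comp_polyM comp_polyX comp_polyC e0 e1.
rewrite -!mul_polyC !exprS !polyCM polyCN; ring.
Qed.

(** Induction on the larger index. Neighbours are orthogonal because their product is odd and [L] is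
    symmetric. Otherwise ['X] is moved to the other factor, which becomes [opoly b i.+1] plus a
    lower term; the case [i = n], where a norm survives, is settled by the choice of [b n]. *)
Lemma opoly_orthogonal i j : L (opoly b i * opoly b j) = (i == j)%:R * opnorm b i.
Proof.
have [->|] := eqVneq i j; first by rewrite mul1r -expr2 Lop_sqr.
rewrite mul0r; wlog ij : i j / (i < j)%N => [W|_].
  by rewrite neq_ltn => /orP[ij|ji]; [|rewrite mulrC]; apply: W; rewrite ?ltn_eqF.
suff H n : (forall i, (i < n)%N -> L (opoly b n * opoly b i) = 0) /\
           (forall i, (i < n.+1)%N -> L (opoly b n.+1 * opoly b i) = 0).
  by rewrite mulrC; apply: (H j).1.
elim: n {i j ij} => [|n [IH0 IH1]].
  split=> // -[|//] _; rewrite /opoly /= mulr1.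
  have := L_sym 'X; rewrite comp_polyX -scaleN1r LZ mulN1r => /eqP.
  by rewrite eq_sym -addr_eq0 -mulr2n mulrn_eq0 => /eqP.
split=> // i; rewrite ltnS leq_eqVlt => /predU1P[->|].
  have := L_sym (opoly b n.+2 * opoly b n.+1).
  rewrite comp_polyM !opoly_comp_oppX -scalerAl -scalerAr scalerA LZ -exprD.
  rewrite -signr_odd oddD /= negbK addbN addbb expr1 mulN1r => /eqP.
  by rewrite eq_sym -addr_eq0 -mulr2n mulrn_eq0 => /eqP.
move=> lei; rewrite opolySS mulrBl LB -mulrA mul_polyC -scalerAl LZ.
have -> : 'X * (opoly b n.+1 * opoly b i) = opoly b n.+1 * ('X * opoly b i).
  by rewrite mulrCA.
have -> : L (opoly b n.+1 * ('X * opoly b i)) = L (opoly b n.+1 * opoly b i.+1).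
  case: i lei => [|i] lei; first by rewrite /opoly /= mulr1.
  have -> : 'X * opoly b i.+1 = (b i) *: opoly b i + opoly b i.+2.
    by rewrite opolySS mul_polyC addrC subrK.
  by rewrite mulrDr -scalerAr L_lin (IH1 i (ltnW lei)) mulr0 add0r.
move: lei; rewrite ltnS leq_eqVlt => /predU1P[->|ltin]; last first.
  by rewrite IH0// IH1 ?mulr0 ?subr0// ltnS.
by rewrite -!expr2 !Lop_sqr opnormS mulrC subrr.
Qed.

End OrthogonalPolynomials.

(** * The Markov-Stieltjes polynomial *)

Lemma rolle_sorted (R : rcfType) (p : {poly R}) x (s : seq R) :
  path <%R x s -> (forall y, y \in x :: s -> root p y) ->
  exists t : seq R, [/\ size t = size s, uniq t &
    forall c, c \in t -> [/\ root p^`() c, c \notin x :: s &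
      x < c < last x s]].
Proof.
elim: s x => [|y s IH] x; first by move=> _ _; exists [::].
rewrite /= => /andP[xy ys] rp.
have [|t [st ut Ht]] := IH y ys.
  by move=> z zs; apply: rp; rewrite in_cons zs orbT.
have [|c /[!in_itv]/= /andP[xc cy] pc] := @poly_rolle _ x y p xy.
  by rewrite (rootP (rp x _)) ?(rootP (rp y _))// !inE eqxx ?orbT.
have y_le z : z \in y :: s -> y <= z.
  rewrite inE => /predU1P[->//|zs]; apply/ltW.
  by move: ys; rewrite (path_sortedE lt_trans) => /andP[/allP/(_ z zs)].
exists (c :: t); split.
- by rewrite /= st.
- rewrite /= ut andbT; apply/negP => /Ht[_ _ /andP[yc _]].
  by have := lt_trans cy yc; rewrite ltxx.
move=> d; rewrite inE => /predU1P[->|/Ht[pd ds /andP[yd dl]]]; split => //.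
- exact/rootP.
- rewrite inE (gt_eqF xc)/=; apply/negP => /y_le.
  by rewrite leNgt cy.
- by rewrite xc (lt_le_trans cy)//= y_le// mem_last.
- by rewrite inE negb_or ds andbT gt_eqF// (lt_trans xy).
- by rewrite (lt_trans xy).
Qed.

(** The critical points lie off [s] and inside its hull, so those found for two separated lists of
    roots are distinct from each other and from all these roots. *)
Lemma rolle_uniq (R : rcfType) (p : {poly R}) (s : seq R) :
  uniq s -> (forall y, y \in s -> root p y) ->
  exists t : seq R, [/\ size t = (size s).-1, uniq t &
    forall c, c \in t -> [/\ root p^`() c, c \notin s &
      exists2 a, a \in s & exists2 b, b \in s & a < c < b]].
Proof.
move=> us rp; case E : (sort <=%R s) => [|x s'].
  exists [::]; split=> //.
  by rewrite -(size_sort <=%R s) E.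
have sE : x :: s' =i s by rewrite -E; exact: mem_sort.
have [||t [st ut Ht]] := @rolle_sorted _ p x s'.
- by have := us; rewrite -sort_lt_sorted E.
- by move=> y; rewrite sE; exact: rp.
exists t; split => //; first by rewrite -(size_sort <=%R s) E.
move=> c /Ht[pc cs xcl]; split => //; first by rewrite -sE.
exists x; first by rewrite -sE mem_head.
by exists (last x s'); rewrite // -sE mem_last.
Qed.

Lemma min_in_seq (R : realDomainType) (s : seq R) : s != [::] ->
  exists2 x, x \in s & forall y, y \in s -> x <= y.
Proof.
move=> s0; case E : (sort <=%R s) => [|x s'].
  by case: s s0 E => // a s _ /(congr1 size); rewrite size_sort.
have sE : x :: s' =i s by rewrite -E; exact: mem_sort.
exists x => [|y]; first by rewrite -sE mem_head.
rewrite -sE inE => /predU1P[->//|ys].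
have : sorted <=%R (x :: s') by rewrite -E sort_le_sorted.
by rewrite /= (path_sortedE le_trans) => /andP[/allP/(_ y ys)].
Qed.

Section MarkovStieltjes.

Variables (R : rcfType) (s1 s2 : seq R).
Hypotheses (us1 : uniq s1) (us2 : uniq s2).
Hypothesis s1_lt0 : forall z, z \in s1 -> z < 0.
Hypothesis s2_gt0 : forall x, x \in s2 -> 0 < x.
Hypothesis s2_neq0 : s2 != [::].

Let u : {poly R} := \prod_(z <- s1) ('X - z%:P).
Let v : {poly R} := \prod_(x <- s2) ('X - x%:P).

Let ru z : root u z = (z \in s1). Proof. exact: root_prod_XsubC. Qed.
Let rv z : root v z = (z \in s2). Proof. exact: root_prod_XsubC. Qed.

Let coprime_nodes : coprimep ('X * u ^+ 2) (v ^+ 2).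
Proof.
apply: coprimep_expr; rewrite coprimepMl; apply/andP; split.
  by rewrite coprimep_sym -[X in coprimep _ X]subr0 coprimep_XsubC rv;
    apply/negP => /s2_gt0; rewrite ltxx.
apply: coprimep_expl; rewrite /u.
elim: s1 s1_lt0 => [|a s IH] lt0; first by rewrite big_nil coprime1p.
rewrite big_cons coprimepMl IH ?andbT; last first.
  by move=> z zs; apply: lt0; rewrite inE zs orbT.
rewrite coprimep_sym coprimep_XsubC rv; apply/negP => /s2_gt0.
by rewrite ltNge ltW// lt0// mem_head.
Qed.

(** Chinese remainders: [P] is 0 modulo [v ^+ 2] and 1 modulo ['X * u ^+ 2], and reduction modulo
    the product bounds its size. Contact is double at every node except 0, where the indicator
    jumps. *)
Let hermite_interpolation : exists P W Y : {poly R},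
  [/\ (size P <= (size s1 + size s2).*2.+1)%N, P = v ^+ 2 * W &
      P - 1 = 'X * u ^+ 2 * Y].
Proof.
have /Bezout_eq1_coprimepP[[U V] /= UV] := coprime_nodes.
set A := 'X * u ^+ 2 in UV *; pose B := A * v ^+ 2.
have B0 : B != 0.
  by rewrite !mulf_neq0 ?expf_neq0 ?polyX_eq0 ?monic_neq0 ?monic_prod_XsubC.
have sB : size B = (size s1 + size s2).*2.+2.
  rewrite /B /A -mulrA mulrC size_mulX -?exprMn; last first.
    by rewrite expf_neq0// mulf_neq0// monic_neq0 ?monic_prod_XsubC.
  have m : u * v \is monic by rewrite monicMl monic_prod_XsubC.
  have s : size (u * v) = (size s1 + size s2).+1.
    rewrite size_monicM ?monic_neq0 ?monic_prod_XsubC//.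
    by rewrite !size_prod_XsubC addSn addnS.
  by rewrite expr2 size_monicM ?monic_neq0// s addSn addnS /= addnn.
pose P := (V * v ^+ 2) %% B; pose Q := (V * v ^+ 2) %/ B.
have PE : P = V * v ^+ 2 - Q * B.
  by rewrite [in RHS](divp_eq (V * v ^+ 2) B) addrC addKr.
exists P, (V - Q * A), (- U - Q * v ^+ 2); split.
- by rewrite -ltnS -sB ltn_modp.
- by rewrite PE /B; ring.
- by rewrite PE -UV /B; ring.
Qed.

(** With [P - 1 = 'X * u ^+ 2 * Y] and [P = v ^+ 2 * W], it suffices that [Y] is negative for
    [x <= 0] and [W] positive for [0 < x]. Each sign is known at one point, and a change of sign
    would give the derivative of [P] more roots than its degree allows. *)
Lemma markov_stieltjes : exists P : {poly R},
  [/\ (size P <= (size s1 + size s2).*2.+1)%N,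
      forall x, x <= 0 -> 1 <= P.[x] ?= iff (x \in 0 :: s1) &
      forall x, 0 < x -> 0 <= P.[x] ?= iff (x \in s2)].
Proof.
have [P [W [Y [sP PW PY]]]] := hermite_interpolation.
have Px x : P.[x] = v.[x] ^+ 2 * W.[x].
  by rewrite PW expr2 !hornerM -expr2.
have P1x x : (P - 1).[x] = x * u.[x] ^+ 2 * Y.[x].
  by rewrite PY [u ^+ 2]expr2 !hornerM hornerX -expr2.
have P0 : P.[0] = 1.
  have /eqP := P1x 0; rewrite !mul0r hornerD hornerN hornerC subr_eq0.
  by move=> /eqP.
have rP x : x \in s2 -> root P x.
  by rewrite -rv => /rootP vx; apply/rootP; rewrite Px vx expr0n mul0r.
have rP1 x : x \in 0 :: s1 -> root (P - 1) x.
  rewrite inE => /predU1P[->|]; first by apply/rootP; rewrite P1x !mul0r.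
  rewrite -ru => /rootP ux; apply/rootP.
  by rewrite P1x ux expr0n mulr0 mul0r.
have [x1 x1s2 x1_min] := min_in_seq s2_neq0.
(* [P] is 1 at 0 and 0 at [x1], so it is not constant and its derivative can be subjected to a count
   of roots. *)
have P'0 : P^`() != 0.
  apply/eqP => P'0.
  have [c _] := @poly_mvt _ 0 x1 P (s2_gt0 x1s2).
  rewrite P'0 horner0 mul0r (rootP (rP x1 x1s2)) P0 sub0r => /eqP.
  by rewrite oppr_eq0 oner_eq0.
have P'E1 : P^`() = u * (u * Y + 'X * (u^`() * Y *+ 2 + u * Y^`())).
  have -> : P^`() = (P - 1)^`() by rewrite derivB derivC subr0.
  rewrite PY expr2 !derivM derivX; ring.
have P'E2 : P^`() = v * (v^`() * W *+ 2 + v * W^`()).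
  by rewrite PW expr2 !derivM; ring.
have us12 : uniq (s1 ++ s2).
  rewrite cat_uniq us1 us2 andbT /=; apply/hasPn => x /s2_gt0 x0.
  by apply/negP => /s1_lt0; rewrite ltNge ltW.
(* Every nonzero node is a double zero of [P - 1] or of [P]. The cofactor [Q] keeps the other
   critical points, fewer than [size s1 + size s2] of them. *)
have /dvdpP[Q P'Q] : u * v %| P^`().
  rewrite /u /v -big_cat /=; apply: uniq_roots_dvdp; last by rewrite uniq_rootsE.
  apply/allP => x; rewrite mem_cat => /orP[].
    by rewrite -ru => /rootP ux; apply/rootP; rewrite P'E1 hornerM ux mul0r.
  by rewrite -rv => /rootP vx; apply/rootP; rewrite P'E2 hornerM vx mul0r.
have Q0 : Q != 0 by apply: contraNneq P'0; rewrite P'Q => ->; rewrite mul0r.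
have u0 : u != 0 by rewrite monic_neq0// monic_prod_XsubC.
have v0 : v != 0 by rewrite monic_neq0// monic_prod_XsubC.
have sQ : (size Q <= size s1 + size s2)%N.
  have : (size P^`() < size P)%N.
    by apply: lt_size_deriv; apply: contraNneq P'0 => ->; rewrite deriv0.
  rewrite P'Q size_mul ?mulf_neq0// size_mul// !size_prod_XsubC.
  rewrite addSn addnS /= addnS /= => /leq_trans/(_ sP).
  by rewrite ltnS -addnn leq_add2r.
(* These two identities show that a zero of [Y] in [0 :: s1], or of [W] in [s2], is also a root of
   [Q]. *)
have vQ : v * Q = u * Y + 'X * (u^`() * Y *+ 2 + u * Y^`()).
  by apply: (mulfI u0); rewrite -P'E1 P'Q; ring.
have uQ : u * Q = v^`() * W *+ 2 + v * W^`().
  by apply: (mulfI v0); rewrite -P'E2 P'Q; ring.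
(* Rolle's theorem on [e1] and on [e2] gives roots of [P'] besides the nodes, i.e.
   roots of [Q]; with [e3] they must not exceed the degree of [Q]. *)
have few_roots (e1 e2 e3 : seq R) :
    uniq e1 -> (forall x, x \in e1 -> root (P - 1) x) -> {subset s1 <= e1} ->
    uniq e2 -> (forall x, x \in e2 -> root P x) -> {subset s2 <= e2} ->
    (forall a c, a \in e1 -> c \in e2 -> a < c) ->
    uniq e3 -> (forall x, x \in e3 -> root Q x /\ x \in e1 ++ e2) ->
    ((size e1).-1 + (size e2).-1 + size e3 < size s1 + size s2)%N.
  move=> ue1 re1 s1e ue2 re2 s2e e12 ue3 re3.
  have [t1 [<- ut1 Ht1]] := rolle_uniq ue1 re1.
  have [t2 [<- ut2 Ht2]] := rolle_uniq ue2 re2.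
  have t1e2 c a : c \in t1 -> a \in e2 -> c < a.
    move=> /Ht1[_ _ [_ _ [d de1 /andP[_ cd]]]] ae2.
    exact: lt_trans cd (e12 _ _ de1 ae2).
  have e1t2 c a : c \in t2 -> a \in e1 -> a < c.
    move=> /Ht2[_ _ [d de2 [_ _ /andP[dc _]]]] ae1.
    exact: lt_trans (e12 _ _ ae1 de2) dc.
  have rQ c : root P^`() c -> c \notin s1 -> c \notin s2 -> root Q c.
    by rewrite P'Q !rootM ru rv => h /negPf h1 /negPf h2; rewrite h1 h2 !orbF in h.
  have ut : uniq (t1 ++ t2 ++ e3).
    rewrite !cat_uniq ut1 ut2 ue3 /= andbT; apply/andP; split.
      apply/hasPn => c; rewrite mem_cat => /orP[ct2|/re3[_]].
        apply/negP => /Ht1[_ _ [_ _ [d de1 /andP[_ cd]]]].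
        by have := lt_trans cd (e1t2 _ _ ct2 de1); rewrite ltxx.
      rewrite mem_cat => /orP[ce|ce]; apply/negP => ct.
        by have [_] := Ht1 _ ct; rewrite ce.
      by have := t1e2 _ _ ct ce; rewrite ltxx.
    apply/hasPn => c /re3[_]; rewrite mem_cat => /orP[ce|ce]; apply/negP => ct.
      by have := e1t2 _ _ ct ce; rewrite ltxx.
    by have [_] := Ht2 _ ct; rewrite ce.
  have rt : all (root Q) (t1 ++ t2 ++ e3).
    apply/allP => c; rewrite !mem_cat => /or3P[ct|ct|/re3[]//].
      have [+ ce _] := Ht1 _ ct; rewrite derivB derivC subr0 => rc; apply: (rQ c rc).
        by apply/negP => /s1e ce1; rewrite ce1 in ce.
      by apply/negP => /s2e /(t1e2 _ _ ct); rewrite ltxx.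
    have [rc ce _] := Ht2 _ ct; apply: (rQ c rc).
      by apply/negP => /s1e /(e1t2 _ _ ct); rewrite ltxx.
    by apply/negP => /s2e ce2; rewrite ce2 in ce.
  apply: leq_trans sQ; rewrite -addnA -!size_cat; exact: max_poly_roots.
have lt12 a c : a \in 0 :: s1 -> c \in s2 -> a < c.
  rewrite inE => /predU1P[->|/s1_lt0 a0] /s2_gt0 //; exact: lt_trans.
have u01 : uniq (0 :: s1).
  by rewrite /= us1 andbT; apply/negP => /s1_lt0; rewrite ltxx.
have ss2 : (0 < size s2)%N by rewrite lt0n size_eq0.
have s1_sub : {subset s1 <= 0 :: s1} by move=> x; rewrite inE orbC => ->.
(* A zero in [0 :: s1] enters the count through [e3], any other one as an additional element of
   [e1]. The range extends beyond 0 up to [x1] because the sign of [Y] is known at [x1]. *)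
have Y_neq0 z : z < x1 -> Y.[z] != 0.
  move=> zx1; apply/eqP => Yz.
  have [ze|ze] := boolP (z \in 0 :: s1).
    have := few_roots (0 :: s1) s2 [:: z] u01 rP1 s1_sub us2 rP
      (fun _ h => h) lt12 isT.
    rewrite /= addn1 -addnS prednK// ltnn => H; apply: notF.
    apply: H => x; rewrite mem_seq1 => /eqP->.
    split; last by rewrite -cat_cons mem_cat ze.
    have : root (v * Q) z.
      apply/rootP; rewrite vQ !hornerE Yz !(mulr0, mul0r) !add0r.
      move: ze; rewrite inE -ru => /predU1P[->|/rootP ->]; last by rewrite mul0r mulr0.
      by rewrite mul0r.
    rewrite rootM rv => /orP[|//] /(lt12 _ _ ze); by rewrite ltxx.
  have := few_roots [:: z, 0 & s1] s2 [::].
  rewrite /= addn0 addSn -addnS prednK// ltnn => H; apply: notF; apply: H => //.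
  - by rewrite ze.
  - move=> x; rewrite inE => /predU1P[->|/rP1//].
    by apply/rootP; rewrite P1x Yz mulr0.
  - by move=> x /s1_sub xs; rewrite in_cons xs orbT.
  - move=> a c; rewrite inE => /predU1P[->|]; last exact: lt12.
    by move=> /x1_min; exact: lt_le_trans.
have W_neq0 z : 0 <= z -> W.[z] != 0.
  rewrite le_eqVlt => /predU1P[<-|z0].
    apply: contraTneq isT => W0; move: P0; rewrite Px W0 mulr0 => /eqP.
    by rewrite eq_sym oner_eq0.
  apply/eqP => Wz.
  have s1z a : a \in 0 :: s1 -> a < z.
    by rewrite inE => /predU1P[->//|/s1_lt0 a0]; exact: lt_trans z0.
  have [ze|ze] := boolP (z \in s2).
    have := few_roots (0 :: s1) s2 [:: z] u01 rP1 s1_sub us2 rP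
      (fun _ h => h) lt12 isT.
    rewrite /= addn1 -addnS prednK// ltnn => H; apply: notF.
    apply: H => x; rewrite mem_seq1 => /eqP->.
    split; last by rewrite -cat_cons mem_cat ze orbT.
    have : root (u * Q) z.
      apply/rootP; rewrite uQ !hornerE Wz !(mulr0, mul0r) add0r.
      by move: ze; rewrite -rv => /rootP ->; rewrite mul0r addr0.
    by rewrite rootM ru => /orP[|//] /s1_sub/s1z; rewrite ltxx.
  have := few_roots (0 :: s1) (z :: s2) [::].
  rewrite /= addn0 ltnn => H; apply: notF; apply: H => //.
  - by rewrite ze.
  - move=> x; rewrite inE => /predU1P[->|/rP//].
    by apply/rootP; rewrite Px Wz mulr0.
  - by move=> x xs; rewrite in_cons xs orbT.
  - by move=> a c /[dup] /s1z az /lt12 as2; rewrite inE => /predU1P[->|/as2].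
have Y_lt0 z : z <= 0 -> Y.[z] < 0.
  move=> z0; have zx1 := le_lt_trans z0 (s2_gt0 x1s2).
  (* The sign comes from [P.[x1] = 0]; the intermediate value theorem then carries it down to
     [z]. *)
  have Yx1 : Y.[x1] < 0.
    have e : x1 * u.[x1] ^+ 2 * Y.[x1] = -1.
      by rewrite -P1x hornerD hornerN hornerC (rootP (rP x1 x1s2)) sub0r.
    rewrite -(pmulr_rlt0 _ (s2_gt0 x1s2)).
    have ux1 : 0 < u.[x1] ^+ 2.
      rewrite exprn_even_gt0//= -[_ == 0]/(root u x1) ru.
      by apply/negP => /s1_sub /lt12 /(_ x1s2); rewrite ltxx.
    by rewrite -(pmulr_rlt0 _ ux1) mulrA [_ * x1]mulrC e ltrN10.
  rewrite ltNge; apply/negP => Yz.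
  have [|y /andP[zy yx1] /rootP Yy] := @poly_ivt _ (- Y) z x1 (ltW zx1).
    by rewrite !hornerN oppr_le0 Yz oppr_ge0 ltW.
  move: Yy => /eqP; rewrite hornerN oppr_eq0 => /eqP Yy.
  move: yx1; rewrite le_eqVlt => /predU1P[yx1|/Y_neq0]; last by rewrite Yy eqxx.
  by move: Yx1; rewrite -yx1 Yy ltxx.
have W_gt0 z : 0 < z -> 0 < W.[z].
  move=> z0; have W0 : 0 < W.[0].
    move: P0; rewrite Px => e.
    have : 0 < v.[0] ^+ 2 * W.[0] by rewrite e.
    rewrite pmulr_rgt0// exprn_even_gt0//= -[_ == 0]/(root v 0) rv.
    by apply/negP => /s2_gt0; rewrite ltxx.
  rewrite ltNge; apply/negP => Wz.
  have [|y /andP[zy yx1]] := @poly_ivt _ (- W) 0 z (ltW z0).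
    by rewrite !hornerN oppr_le0 (ltW W0) oppr_ge0.
  rewrite rootN => /rootP Wy.
  by have := W_neq0 y zy; rewrite Wy eqxx.
exists P; split => // x x0.
  have -> : P.[x] = 1 + x * u.[x] ^+ 2 * Y.[x].
    by rewrite -P1x hornerD hornerN hornerC addrC subrK.
  split.
    by rewrite lerDl mulr_le0 ?(ltW (Y_lt0 _ x0))// mulr_le0_ge0 ?sqr_ge0.
  rewrite -subr_eq0 opprD addrA subrr sub0r oppr_eq0 !mulf_eq0 orbb.
  by rewrite (lt_eqF (Y_lt0 _ x0)) orbF inE -ru.
rewrite Px; split; first by rewrite mulr_ge0 ?sqr_ge0// ltW// W_gt0.
by rewrite eq_sym !mulf_eq0 orbb (gt_eqF (W_gt0 _ x0)) orbF -rv.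
Qed.

End MarkovStieltjes.

(** * Moments of the standard normal distribution *)

Section Density.

Context d (T : measurableType d) (R : realType).
Variables (mu P : {measure set T -> \bar R}) (g : T -> R).
Hypothesis mg : measurable_fun [set: T] g.
Hypothesis g_ge0 : forall x, 0 <= g x.
Hypothesis P_density :
  forall A, measurable A -> P A = (\int[mu]_(x in A) (g x)%:E)%E.

Let integral_density_nnsfun (f : {nnsfun T >-> R}) :
  (\int[P]_x (f x)%:E = \int[mu]_x ((f x)%:E * (g x)%:E))%E.
Proof.
under [LHS]eq_integral do rewrite fimfunE -fsumEFin//.
rewrite [LHS]ge0_integral_fsum//; last 2 first.
  - by move=> r; exact/measurable_EFinP/measurableT_comp.
  - by move=> n x _; rewrite EFinM nnfun_muleindic_ge0.
under [RHS]eq_integral.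
  move=> x xD; rewrite fimfunE -fsumEFin// ge0_mule_fsuml; last first.
    by move=> r; rewrite EFinM nnfun_muleindic_ge0.
  over.
rewrite [RHS]ge0_integral_fsum//; last 2 first.
  - move=> r; apply: emeasurable_funM; last exact/measurable_EFinP.
    by apply/measurable_EFinP; do 2 apply/measurableT_comp => //.
  - move=> n x _; apply: mule_ge0; last by rewrite lee_fin.
    by rewrite EFinM nnfun_muleindic_ge0.
apply: eq_fsbigr => r _.
under eq_integral do rewrite EFinM.
under [RHS]eq_integral do rewrite EFinM.
have mfr : measurable (f @^-1` [set r]) by exact: measurable_sfunP.
rewrite integralZl_indic_nnsfun//= integral_indic// setIT P_density//.
rewrite integral_mkcond/=.
have [r0|r0] := leP 0 r; last first.
  have fr0 : f @^-1` [set r] = set0.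
    apply/seteqP; split=> // x /= fxr; have : 0 <= f x by [].
    by rewrite fxr leNgt r0.
  rewrite fr0 !integral0_eq ?mule0// => x _.
    by rewrite indic0 mule0 mul0e.
  by rewrite patch_set0.
rewrite -ge0_integralZl//.
- apply: eq_integral => x _; rewrite patchE indicE -muleA.
  by case: ifPn => _; rewrite ?mul1e ?mul0e.
- apply/(measurable_restrictT _ _).1 => //.
  by apply/measurable_funTS/measurable_EFinP.
- by move=> x _; rewrite patchE; case: ifPn => _; rewrite ?lee_fin.
Qed.

Lemma ge0_integral_density (f : T -> \bar R) :
  measurable_fun [set: T] f -> (forall x, 0 <= f x)%E ->
  (\int[P]_x f x = \int[mu]_x (f x * (g x)%:E))%E.
Proof.
move=> mf f0; pose f_ := nnsfun_approx measurableT mf.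
transitivity (lim (\int[P]_x (f_ n x)%:E @[n --> \oo])%E).
  rewrite -monotone_convergence//=.
  - apply: eq_integral => ? _; apply/esym/cvg_lim => //=.
    exact: cvg_nnsfun_approx.
  - by move=> n; exact/measurable_EFinP/measurable_funTS.
  - by move=> n ? _; rewrite lee_fin.
  - by move=> ? _ ? ? mn; rewrite lee_fin; exact/lefP/nd_nnsfun_approx.
under eq_fun do rewrite integral_density_nnsfun.
rewrite -monotone_convergence//=.
- apply: eq_integral => x _; apply/cvg_lim => //=.
  apply: cvgeZr => //; exact: cvg_nnsfun_approx.
- move=> n; apply: emeasurable_funM; last exact/measurable_EFinP.
  exact/measurable_EFinP/measurable_funTS.
- by move=> n ? _; rewrite mule_ge0// lee_fin.
- move=> ? _ ? ? mn; rewrite lee_wpmul2r ?lee_fin//.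
  exact/lefP/nd_nnsfun_approx.
Qed.

End Density.

(** The power is at most [1 + (x ^+ 2) ^+ n.+1], and one term of the exponential series at
    [x ^+ 2 / 4] bounds the latter. The rate 1/4 is half of that in the normal density, which leaves
    an integrable factor. *)
Lemma expr_le_expR (R : realType) (x : R) n :
  `|x ^+ n| <= (1 + 4 ^+ n.+1 * (n.+1)`!%:R) * expR (x ^+ 2 / 4).
Proof.
have y0 : 0 <= x ^+ 2 / 4 by rewrite divr_ge0// sqr_ge0.
have e1 : 1 <= expR (x ^+ 2 / 4) by rewrite -[leLHS]expR0 ler_expR.
have xn : `|x ^+ n| <= 1 + (x ^+ 2) ^+ n.+1.
  rewrite normrX -(real_normK (num_real x)) -exprM.
  have [x1|x1] := leP `|x| 1.
    by rewrite ler_wpDr ?exprn_ile1// exprn_ge0.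
  rewrite ler_wpDl// ler_weXn2l ?(ltW x1)// mul2n -addnn.
  by rewrite (leq_trans (leqnSn n))// leq_addr.
apply: (le_trans xn); rewrite mulrDl mul1r lerD//.
have := expR_ge1Dxn n y0; set e := expR _ => h.
have -> : (x ^+ 2) ^+ n.+1 = 4 ^+ n.+1 * (x ^+ 2 / 4) ^+ n.+1.
  by rewrite -exprMn mulrC divfK.
rewrite -mulrA ler_wpM2l ?exprn_ge0// [leRHS]mulrC -ler_pdivrMr ?ltr0n ?fact_gt0//.
by apply: le_trans h; rewrite ler_wpDl.
Qed.

Section StandardNormal.

Variable R : realType.
Local Notation Z := (std_normal R).
Local Notation mu := (@lebesgue_measure R).

Lemma lebesgue_measureN (A : set (measurableTypeR R)) :
  measurable A -> mu (-%R @^-1` A) = mu A.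
Proof.
move=> mA; have mN : measurable_fun [set: measurableTypeR R]
    (-%R : _ -> measurableTypeR R).
  exact: oppr_measurable.
rewrite [RHS](@lebesgue_measure_unique _
  (pushforward mu (-%R : _ -> measurableTypeR R)))//.
move=> _ [[a b] _ <-].
have E : -%R @^-1` `]a, b] = `[(- b)%R, (- a)%R[%classic.
  by apply/seteqP; split=> x /=; rewrite !in_itv/= lerNl ltrNr andbC.
rewrite -[RHS]/(mu (-%R @^-1` `]a, b])) E.
rewrite !lebesgue_measure_itv/= !lte_fin ltrN2 -!EFinB opprK.
by rewrite [(- a + b)%R]addrC.
Qed.

Lemma normal_pdf01 (x : R) :
  normal_pdf 0 1 x = (Num.sqrt (pi *+ 2))^-1 * expR (- x ^+ 2 / 2).
Proof.
rewrite normal_pdfE ?oner_eq0// /normal_peak /normal_fun subr0.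
by rewrite !expr1n mul1r.
Qed.

Lemma std_normalN (A : set (measurableTypeR R)) :
  measurable A -> Z (-%R @^-1` A) = Z A.
Proof.
move=> mA; have mN : measurable_fun [set: measurableTypeR R]
    (-%R : _ -> measurableTypeR R).
  exact: oppr_measurable.
rewrite /std_normal /= /normal_prob.
rewrite -[RHS](@eq_measure_integral _ _ _ _ mu
  (pushforward mu (-%R : _ -> measurableTypeR R))); last first.
  by move=> B mB _; exact: lebesgue_measureN.
rewrite ge0_integral_pushforward//=.
- by apply: eq_integral => x _; rewrite /= !normal_pdf01 sqrrN.
- by apply/measurable_EFinP/measurable_funTS; exact: measurable_normal_pdf.
- by move=> x _; rewrite lee_fin normal_pdf_ge0.
Qed.

Lemma std_normal1 (x : R) : Z [set x] = 0%E.
Proof. by rewrite /std_normal /= /normal_prob integral_set1. Qed.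

Lemma std_normal_cdf0 : dcdf Z 0 = (2^-1)%:E.
Proof.
rewrite /dcdf /cdf /distribution /pushforward /=.
rewrite -[LHS]/(Z `]-oo, 0%R]%classic).
have e1 : Z `]-oo, 0%R]%classic = Z `[0%R, +oo[%classic.
  rewrite -std_normalN//; congr (Z _); apply/seteqP.
  by split=> x /=; rewrite !in_itv/= ?andbT oppr_le0.
have e2 : Z `[0%R, +oo[%classic = Z `]0%R, +oo[%classic.
  rewrite -(@setU1itv _ _ _ _ false)// measureU//; last first.
    by apply/seteqP; split=> // x [/= -> /[!in_itv]/=]; rewrite ltxx.
  by rewrite [X in (X + _)%E](_ : _ = 0%E) ?add0e//; exact: std_normal1.
have : (Z `]-oo, 0%R]%classic + Z `]0%R, +oo[%classic = 1)%E.
  rewrite -measureU//; last first.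
    apply/seteqP; split=> // x [] /=; rewrite !in_itv/= andbT => x0.
    by rewrite ltNge x0.
  by rewrite -setCitvl setUv; exact: (@probability_setT _ _ _ Z).
rewrite -e2 -e1.
have : (Z `]-oo, 0%R]%classic) \is a fin_num by exact: fin_num_measure.
move: (Z _) => [r| |]//= _; rewrite -EFinD => -[rr].
by congr EFin; lra.
Qed.

Lemma integrable_std_normal_expr n :
  Z.-integrable [set: measurableTypeR R] (fun x : R => (x ^+ n)%:E).
Proof.
have mx : measurable_fun [set: R] (fun x : R => (x ^+ n)%:E).
  by apply/measurable_EFinP; exact: exprn_measurable.
have mxn : measurable_fun [set: R] (fun x : R => `|x ^+ n|%:E).
  apply/measurable_EFinP.
  apply: (@measurableT_comp _ _ _ _ _ _ (@Num.norm _ R) _ (fun x : R => x ^+ n)).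
    exact: normr_measurable.
  exact: exprn_measurable.
apply/integrableP; split => //.
rewrite (@ge0_integral_density _ _ _ mu Z (normal_pdf 0 1))//=; last 2 first.
- exact: measurable_normal_pdf.
- by move=> x; exact: normal_pdf_ge0.
have s2 : Num.sqrt 2 != 0 :> R by rewrite gt_eqF// sqrtr_gt0.
pose K : R := 1 + 4 ^+ n.+1 * (n.+1)`!%:R.
(* The factor [exp(-x^2/2)] is split into two factors [exp(-x^2/4)]: one absorbs the power at the
   cost of [K], the other is the unnormalized density with standard deviation [Num.sqrt 2]. The rest
   of [c] exchanges the normalizing constants. *)
pose c : R := K * (Num.sqrt (pi *+ 2))^-1 / normal_peak (Num.sqrt 2).
have c0 : 0 <= c.
  rewrite !mulr_ge0 ?invr_ge0 ?sqrtr_ge0 ?normal_peak_ge0//.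
  by rewrite addr_ge0// mulr_ge0// exprn_ge0.
apply: (@le_lt_trans _ _
    (\int[mu]_x (c%:E * (normal_pdf 0 (Num.sqrt 2) x)%:E))%E); last first.
  rewrite integralZl//=; last exact: integrable_normal_pdf.
  by rewrite integral_normal_pdf mule1 ltry.
apply: ge0_le_integral => //=.
- by move=> x _; rewrite lee_fin mulr_ge0// normal_pdf_ge0.
- apply: emeasurable_funM; first exact: mxn.
  by apply/measurable_EFinP; exact: measurable_normal_pdf.
- apply: emeasurable_funM; first exact: measurable_cst.
  by apply/measurable_EFinP; exact: measurable_normal_pdf.
move=> x _; rewrite -!EFinM lee_fin normal_pdf01 normal_pdfE// /normal_fun subr0.
rewrite sqr_sqrtr// /c.
have p0 : normal_peak (Num.sqrt 2 : R) != 0 by rewrite gt_eqF// normal_peak_gt0.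
set a := (Num.sqrt (pi *+ 2))^-1; set e1 := expR (_ / (2 *+ 2)).
have -> : expR (- x ^+ 2 / 2) = e1 * expR (- (x ^+ 2 / 4)).
  by rewrite -expRD; congr expR; field.
have -> : K * a / normal_peak (Num.sqrt 2) * (normal_peak (Num.sqrt 2) * e1)
    = a * e1 * K by field.
rewrite mulrC mulrA -[leLHS]mulrA ler_wpM2l//.
  by rewrite mulr_ge0 ?expR_ge0// invr_ge0 sqrtr_ge0.
by rewrite mulrC expRN ler_pdivrMr ?expR_gt0// expr_le_expR.
Qed.

End StandardNormal.

(** * Means of polynomials *)

Definition poly_mean (R : realType) (mu : distr R) (p : {poly R}) : R :=
  \int[mu]_x p.[x].

Lemma distr_setT (R : realType) (mu : distr R) : mu [set: R] = 1%E.
Proof. exact: (@probability_setT _ _ _ mu). Qed.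

Section PolyMean.

Variables (R : realType) (mu : distr R).

Lemma integrable_cst1 : mu.-integrable [set: measurableTypeR R] (fun=> 1%:E).
Proof.
by apply: finite_measure_integrable_cst.
Qed.

Lemma integral_expr0 : (\int[mu]_x (x ^+ 0)%:E = 1)%E.
Proof.
under eq_integral do rewrite expr0.
by rewrite integral_cst// [X in (_ * X)%E]distr_setT mul1e.
Qed.

Lemma integrable_horner (p : {poly R}) :
  (forall i, (i < size p)%N ->
    mu.-integrable [set: measurableTypeR R] (fun x : R => (x ^+ i)%:E)) ->
  mu.-integrable [set: measurableTypeR R] (fun x : R => p.[x]%:E).
Proof.
move=> int_x.
under eq_fun do rewrite horner_coef -sumEFin.
apply: integrable_sum => // i _.
under eq_fun do rewrite EFinM.
by apply: integrableZl => //; exact: int_x.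
Qed.

Lemma poly_mean_coef (p : {poly R}) :
  (forall i, (i < size p)%N ->
    mu.-integrable [set: measurableTypeR R] (fun x : R => (x ^+ i)%:E)) ->
  poly_mean mu p = \sum_(i < size p) p`_i * fine (\int[mu]_x (x ^+ i)%:E).
Proof.
move=> int_x; rewrite /poly_mean /Rintegral.
under eq_integral do rewrite horner_coef -sumEFin.
rewrite integral_sum//; last first.
  move=> i; under eq_fun do rewrite EFinM.
  by apply: integrableZl => //; exact: int_x.
under eq_bigr => i _.
  under eq_integral do rewrite EFinM.
  rewrite integralZl//; last exact: int_x.
  rewrite -(fineK (integrable_fin_num _ (int_x i (ltn_ord i))))// -EFinM.
  over.
by rewrite sumEFin.
Qed.

Lemma poly_mean_linear a (p q : {poly R}) :
  mu.-integrable [set: measurableTypeR R] (fun x : R => p.[x]%:E) ->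
  mu.-integrable [set: measurableTypeR R] (fun x : R => q.[x]%:E) ->
  poly_mean mu (a *: p + q) = a * poly_mean mu p + poly_mean mu q.
Proof.
move=> ip iq; rewrite /poly_mean -RintegralZl// -RintegralD//.
  by apply: eq_Rintegral => x _; rewrite hornerD hornerZ.
by apply: (integrableZl _ _ ip).
Qed.

Lemma poly_mean1 : poly_mean mu 1 = 1.
Proof.
rewrite /poly_mean /Rintegral; under eq_integral do rewrite hornerC.
by rewrite integral_cst// [X in (_ * X)%E]distr_setT mul1e.
Qed.

End PolyMean.

Section NormalMean.

Variable R : realType.
Local Notation Z := (std_normal R).

Lemma integrable_std_normal_horner (p : {poly R}) :
  Z.-integrable [set: measurableTypeR R] (fun x : R => p.[x]%:E).
Proof. by apply: integrable_horner => i _; exact: integrable_std_normal_expr. Qed.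

Lemma matches_integrable k (mu : distr R) (p : {poly R}) :
  matches_moments k mu -> (size p <= k.*2.+1)%N ->
  mu.-integrable [set: measurableTypeR R] (fun x : R => p.[x]%:E).
Proof.
move=> mk sp; apply: integrable_horner => -[|i] isp.
  by under eq_fun do rewrite expr0; exact: integrable_cst1.
by apply: (mk i.+1 _).1; rewrite /= -ltnS (leq_trans isp).
Qed.

Lemma matches_poly_mean k (mu : distr R) (p : {poly R}) :
  matches_moments k mu -> (size p <= k.*2.+1)%N ->
  poly_mean mu p = poly_mean Z p.
Proof.
move=> mk sp; rewrite !poly_mean_coef; last 2 first.
- move=> i _; exact: integrable_std_normal_expr.
- move=> [|i] isp; first by under eq_fun do rewrite expr0; exact: integrable_cst1.
  by apply: (mk i.+1 _).1; rewrite /= -ltnS (leq_trans isp).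
apply: eq_bigr => -[[|i] isp] _ /=.
  by rewrite !integral_expr0.
have := (mk i.+1 _).2; rewrite /= -ltnS (leq_trans isp)// => /(_ isT).
by rewrite unlock => ->.
Qed.

Lemma matches_momentsP k (mu : distr R) :
  (forall p : {poly R},
    mu.-integrable [set: measurableTypeR R] (fun x : R => p.[x]%:E)) ->
  (forall p : {poly R}, (size p <= k.*2.+1)%N -> poly_mean mu p = poly_mean Z p) ->
  matches_moments k mu.
Proof.
move=> imu emu j /andP[_ jk].
have ij : mu.-integrable [set: measurableTypeR R] (fun x : R => (x ^+ j)%:E).
  by have := imu 'X^j; under eq_fun do rewrite hornerXn.
split=> //; rewrite unlock.
rewrite -[LHS]fineK ?integrable_fin_num// -[RHS]fineK; last first.
  by apply: integrable_fin_num => //; exact: integrable_std_normal_expr.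
congr EFin; have := emu 'X^j; rewrite size_polyXn ltnS => /(_ jk).
rewrite /poly_mean /Rintegral.
by under eq_integral do rewrite hornerXn; under [in RHS]eq_integral do rewrite hornerXn.
Qed.

Lemma poly_mean_std_normal_sym (p : {poly R}) :
  poly_mean Z (p \Po - 'X) = poly_mean Z p.
Proof.
have mN : measurable_fun [set: measurableTypeR R] (-%R : _ -> measurableTypeR R).
  exact: oppr_measurable.
rewrite /poly_mean /Rintegral; congr fine.
rewrite -[RHS](@eq_measure_integral _ _ _ _ Z
  (pushforward Z (-%R : _ -> measurableTypeR R))); last first.
  by move=> B mB _; exact: std_normalN.
have E : (EFin \o horner p) \o -%R = (fun x => (p \Po - 'X).[x]%:E).
  by apply/funext => x /=; rewrite horner_comp hornerN hornerX.
rewrite integral_pushforward//=.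
- by apply: eq_integral => x _ /=; rewrite horner_comp hornerN hornerX.
- by apply/measurable_EFinP; exact: measurable_poly.
- by rewrite E; exact: integrable_std_normal_horner.
Qed.

(** If the mean were 0, [p] would vanish almost surely and the whole mass would lie in a finite set
    of roots, which is null for an absolutely continuous distribution. *)
Lemma poly_mean_std_normal_sqr_gt0 (p : {poly R}) :
  p != 0 -> 0 < poly_mean Z (p ^+ 2).
Proof.
move=> p0; have ip := integrable_std_normal_horner (p ^+ 2).
have p2 x : 0 <= (p ^+ 2).[x] by rewrite horner_exp sqr_ge0.
have I0 : (0 <= \int[Z]_x ((p ^+ 2).[x])%:E)%E.
  by apply: integral_ge0 => x _; rewrite lee_fin.
rewrite lt_neqAle /poly_mean /Rintegral fine_ge0// andbT.
apply/negP => /eqP/esym e.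
have /ae_eq_integral_abs : (\int[Z]_x `|((p ^+ 2).[x])%:E| = 0)%E.
  under eq_integral do rewrite gee0_abs ?lee_fin//.
  by rewrite -[LHS]fineK ?e// integrable_fin_num.
move=> /(_ measurableT (measurable_int _ ip)) [N [mN N0 sub]].
have fin : finite_set [set x | root p x].
  apply/finite_seqP; exists (rootsR p); apply/seteqP.
  by split=> x /=; rewrite -(roots_on_rootsR p0) in_itv.
have mr : measurable ([set x | root p x] : set (measurableTypeR R)).
  apply: countable_measurable => [t|]; first exact: measurable_set1.
  exact: finite_set_countable.
have r0 : Z [set x | root p x] = 0%E.
  apply: (proj1 (null_content_dominatesP _ _) (normal_prob_dominates 0 1)) => //.
  by apply: countable_lebesgue_measure0; exact: finite_set_countable.
have : (Z [set: R] <= Z ([set x | root p x] `|` N))%E.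
  apply: le_measure; rewrite ?inE//; first exact: measurableU.
  move=> x _; have [px|px] := boolP (root p x); [by left|right].
  apply: sub => /= /(_ I) [] /eqP; rewrite horner_exp expf_eq0/= => px0.
  by move: px; rewrite /root px0.
rewrite distr_setT leNgt; apply/negP; rewrite negbK.
apply: le_lt_trans (lte01 : 0 < 1 :> \bar R)%E.
by rewrite -[leRHS](adde0 0%E) -{1}r0 -N0; exact: measureU2.
Qed.

End NormalMean.

(** * Discrete distributions *)

(** The absolute value makes this a measure for every [w]; it disappears once the weights are
    nonnegative on [s]. *)
Definition point_masses (R : realType) (s : seq R) (w : R -> R) :
    set (measurableTypeR R) -> \bar R :=
  msum (fun i => mscale `|w s`_i|%:nng \d_(s`_i : measurableTypeR R)) (size s).

HB.instance Definition _ (R : realType) (s : seq R) (w : R -> R) :=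
  Measure.on (point_masses s w).

Section PointMasses.

Variables (R : realType) (s : seq R) (w : R -> R).
Hypothesis w_ge0 : forall x, x \in s -> 0 <= w x.

Lemma point_massesE (A : set R) :
  point_masses s w A = (\sum_(x <- s | x \in A) w x)%:E.
Proof.
rewrite /point_masses /msum (big_nth 0) big_mkord -sumEFin big_mkcond/=.
rewrite [RHS]big_mkcond/=.
apply: eq_bigr => i _; rewrite /mscale/= diracE ger0_norm; last first.
  by apply: w_ge0; rewrite mem_nth.
by case: (_ \in A); rewrite ?mule1 ?mule0.
Qed.

Lemma ge0_integral_point_masses (f : R -> \bar R) :
  measurable_fun [set: R] f -> (forall x, 0 <= f x)%E ->
  (\int[point_masses s w]_x f x = \sum_(x <- s) (w x)%:E * f x)%E.
Proof.
move=> mf f0; rewrite /point_masses ge0_integral_measure_sum//.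
rewrite (big_nth 0) big_mkord; apply: eq_bigr => i _.
rewrite ge0_integral_mscale//= integral_dirac//= diracT mul1e.
by rewrite ger0_norm// w_ge0// mem_nth.
Qed.

End PointMasses.

Lemma discrete_distr (R : realType) (s : seq R) (w : R -> R) :
  (forall x, x \in s -> 0 <= w x) -> \sum_(x <- s) w x = 1 ->
  exists mu : distr R,
    (forall A, mu A = (\sum_(x <- s | x \in A) w x)%:E) /\
    (forall f : R -> R, measurable_fun [set: R] f ->
      mu.-integrable [set: measurableTypeR R] (EFin \o f) /\
      \int[mu]_x f x = \sum_(x <- s) w x * f x).
Proof.
move=> w0 w1; pose m := point_masses s w.
have m1 : m [set: measurableTypeR R] = 1%E.
  rewrite /m point_massesE// (eq_bigl xpredT) ?w1// => x; exact: in_setT.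
(* Normalizing yields a probability by construction. It changes nothing, since the total mass is 1;
   the Dirac mass is the default for degenerate measures. *)
pose mu : distr R := mnormalize m \d_(0 : measurableTypeR R).
have muE : mu = m :> (set _ -> \bar R).
  apply/funext => A; rewrite /mu /= /mnormalize/= -/m m1.
  by rewrite onee_eq0/= invr1 mule1.
exists mu; split=> [A|f mf]; first by rewrite muE /m point_massesE.
have mfE : measurable_fun [set: R] (EFin \o f) by exact/measurable_EFinP.
have intE (g : R -> \bar R) : (\int[mu]_x g x = \int[m]_x g x)%E.
  by apply: eq_measure_integral => A _ _; exact: (congr1 (@^~ A) muE).
split.
  apply/integrableP; split => //.
  rewrite intE ge0_integral_point_masses//; last exact: measurableT_comp.
  under eq_bigr do rewrite -EFinM.
  by rewrite sumEFin ltry.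
rewrite /Rintegral integralE !intE.
rewrite !ge0_integral_point_masses//; last 2 first.
- exact: measurable_funeneg.
- exact: measurable_funepos.
under eq_bigr do rewrite funeposE /= -EFin_max -EFinM.
under [X in (_ - X)%E]eq_bigr do rewrite funenegE /= -EFin_max -EFinM.
rewrite !sumEFin -EFinB/= -sumrB; apply: eq_bigr => x _; rewrite -mulrBr.
congr (_ * _); have [fx|fx] := leP 0 (f x).
  by rewrite max_r ?subr0// oppr_le0.
by rewrite sub0r max_l ?opprK// oppr_ge0 ltW.
Qed.

(** * The bound on the gap *)

(** By reflection the sums over [x <= 0] and over [0 <= x] agree; together they count 0 twice and
    every other point once. *)
Lemma sum_nonpos_half (R : realFieldType) (s : seq R) (w : R -> R) :
  uniq s -> 0 \in s -> (forall x, x \in s -> - x \in s) ->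
  (forall x, w (- x) = w x) -> \sum_(x <- s) w x = 1 ->
  \sum_(x <- s | x <= 0) w x = (1 + w 0) / 2.
Proof.
move=> us s0 sN wN w1.
have ps : perm_eq s (map -%R s).
  apply: uniq_perm => //; first by rewrite map_inj_uniq//; exact: oppr_inj.
  move=> x; apply/idP/mapP => [xs|[y ys ->]]; last exact: sN.
  by exists (- x); rewrite ?opprK// sN.
have e : \sum_(x <- s | 0 <= x) w x = \sum_(x <- s | x <= 0) w x.
  rewrite (perm_big _ ps) big_map; apply: eq_big => x; first by rewrite oppr_ge0.
  by rewrite wN.
have : \sum_(x <- s | x <= 0) w x + \sum_(x <- s | 0 <= x) w x = 1 + w 0.
  have -> : w 0 = \sum_(x <- s | x == 0) w x.
    by rewrite -big_filter filter_pred1_uniq// big_seq1.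
  rewrite -w1 big_mkcond [X in _ + X]big_mkcond [X in _ = _ + X]big_mkcond.
  rewrite -!big_split/=; apply: eq_bigr => x _.
  by case: (ltgtP x 0); rewrite ?addr0 ?add0r.
by rewrite e -mulr2n -[_ *+ 2]mulr_natr => <-; rewrite mulfK.
Qed.

Lemma indic_le_poly_mean (R : realType) (nu : distr R)
    (A : set (measurableTypeR R)) (p : {poly R}) :
  measurable A ->
  nu.-integrable [set: measurableTypeR R] (fun x : R => p.[x]%:E) ->
  (forall x : R, \1_A x <= p.[x]) ->
  fine (nu A) <= poly_mean nu p.
Proof.
move=> mA ip Ap.
have iA : nu.-integrable [set: measurableTypeR R] (fun x : R => (\1_A x)%:E).
  by apply: integrable_indic => //.
have -> : fine (nu A) = \int[nu]_x \1_A x.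
  by rewrite /Rintegral integral_indic// setIT.
by apply: le_Rintegral => //.
Qed.

Lemma Rintegral_eq0_of_ae_ge0 d (T : measurableType d) (R : realType)
    (mu : {measure set T -> \bar R}) (f g : T -> R) :
  mu.-integrable [set: T] (EFin \o f) -> measurable_fun [set: T] g ->
  {ae mu, forall x, 0 <= f x} -> \int[mu]_x f x = 0 ->
  (forall x, f x = 0 -> g x = 0) -> \int[mu]_x g x = 0.
Proof.
move=> intf mg f0 If fg; have mf := measurable_int _ intf.
have /ae_eq_integral_abs : (\int[mu]_x `|(f x)%:E| = 0)%E.
  rewrite -[RHS](_ : (\int[mu]_x (f x)%:E = 0)%E); last first.
    by rewrite -[LHS]fineK ?integrable_fin_num//; congr EFin.
  apply: ae_eq_integral => //; first exact: measurableT_comp.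
  by apply: filterS f0 => x fx _; rewrite gee0_abs.
move=> /(_ measurableT mf) ae.
rewrite /Rintegral (ae_eq_integral (cst 0%E)) ?integral0//=.
  exact/measurable_EFinP.
by apply: filterS ae => x /= /(_ I) [] /fg ->.
Qed.

(** The equality case of [indic_le_poly_mean]: the nonnegative function [p - \1_A] has mean 0, so
    [p] agrees with [\1_A] almost surely, and there [q] vanishes. *)
Lemma indic_eq_poly_mean (R : realType) (nu : distr R) (A : set (measurableTypeR R))
    (p q : {poly R}) :
  measurable A ->
  nu.-integrable [set: measurableTypeR R] (fun x : R => p.[x]%:E) ->
  (forall x : R, \1_A x <= p.[x]) -> fine (nu A) = poly_mean nu p ->
  (forall x : R, p.[x] = \1_A x -> q.[x] = 0) ->
  poly_mean nu q = 0.
Proof.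
move=> mA ip Ap e pq.
have iA : nu.-integrable [set: measurableTypeR R] (fun x : R => (\1_A x)%:E).
  by apply: integrable_indic => //.
have eA : fine (nu A) = \int[nu]_x \1_A x.
  by rewrite /Rintegral integral_indic// setIT.
apply: (@Rintegral_eq0_of_ae_ge0 _ (measurableTypeR R) R nu
  (fun x => p.[x] - \1_A x) (horner q)).
- by rewrite /comp; under eq_fun do rewrite EFinB; exact: integrableB.
- exact: measurable_poly.
- exists set0; split=> // x; apply: contra_notP => _ /=.
  by rewrite subr_ge0.
- by rewrite RintegralB// -eA e subrr.
- by move=> x /eqP; rewrite subr_eq0 => /eqP /pq.
Qed.

Lemma poly_mean_eq0_on (R : realType) (nu : distr R) (A : set (measurableTypeR R))
    (p q : {poly R}) :
  measurable A ->
  nu.-integrable [set: measurableTypeR R] (fun x : R => p.[x]%:E) ->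
  nu A = 1%E -> (forall x : R, A x -> 0 <= p.[x]) -> poly_mean nu p = 0 ->
  (forall x : R, p.[x] = 0 -> q.[x] = 0) ->
  poly_mean nu q = 0.
Proof.
move=> mA ip A1 pA p0 pq.
apply: (@Rintegral_eq0_of_ae_ge0 _ (measurableTypeR R) R nu
  (horner p) (horner q)) => //.
  exact: measurable_poly.
exists (~` A); split; first exact: measurableC.
  transitivity (1 - nu A)%E; first exact: probability_setC.
  by rewrite A1 subee.
by move=> x /=; apply: contra_not => /pA.
Qed.

(** * Gauss rules as distributions *)

Section GaussDistribution.

Variables (R : realType) (c : nat -> R).
Hypothesis c_gt0 : forall i, 0 < c i.

Lemma opoly_odd_root0 n : odd n -> root (opoly c n) 0.
Proof.
move=> on; apply/rootP; have := horner_opolyN c n 0.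
rewrite oppr0 -signr_odd on expr1 mulN1r => /eqP.
by rewrite -addr_eq0 -mulr2n mulrn_eq0 => /eqP.
Qed.

Lemma opoly_rootN n x : root (opoly c n) (- x) = root (opoly c n) x.
Proof. by rewrite /root horner_opolyN mulf_eq0 signr_eq0. Qed.

Lemma sum_gauss_weight n (s : seq R) :
  opoly c n.+1 = \prod_(x <- s) ('X - x%:P) ->
  \sum_(x <- s) gauss_weight c n.+1 x = 1.
Proof.
move=> ps; have := gauss_orthogonal c_gt0 ps (ltn0Sn n) (ltn0Sn n).
rewrite eqxx opnorm0 mul1r => <-; apply: eq_bigr => x _.
by rewrite /opoly /= hornerC !mulr1.
Qed.

Lemma sum_gauss_weight_nonpos n (s : seq R) :
  odd n -> opoly c n = \prod_(x <- s) ('X - x%:P) ->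
  \sum_(x <- s | x <= 0) gauss_weight c n x = (1 + gauss_weight c n 0) / 2.
Proof.
move=> on ps; have rs x : (x \in s) = root (opoly c n) x by rewrite ps root_prod_XsubC.
apply: sum_nonpos_half.
- exact: opoly_roots_uniq ps.
- by rewrite rs opoly_odd_root0.
- by move=> x; rewrite !rs opoly_rootN.
- exact: gauss_weightN.
- by case: n on ps {rs} => // n _; exact: sum_gauss_weight.
Qed.

(** Exactness is recorded as orthogonality up to index [n], the form that [gauss_matches_moments]
    converts into moments. *)
Lemma gauss_distr n (s : seq R) :
  opoly c n.+1 = \prod_(x <- s) ('X - x%:P) ->
  exists mu : distr R,
    [/\ forall A, mu A = (\sum_(x <- s | x \in A) gauss_weight c n.+1 x)%:E,
        forall p : {poly R},
          mu.-integrable [set: measurableTypeR R] (fun x : R => p.[x]%:E),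
        forall p : {poly R},
          poly_mean mu p = \sum_(x <- s) gauss_weight c n.+1 x * p.[x] &
        forall i j, (i <= n)%N -> (j <= n)%N ->
          poly_mean mu (opoly c i * opoly c j) = (i == j)%:R * opnorm c i].
Proof.
move=> ps.
have [||mu [muA muf]] := @discrete_distr R s (gauss_weight c n.+1).
- by move=> x _; rewrite ltW// gauss_weight_gt0.
- exact: sum_gauss_weight.
have mp (p : {poly R}) : measurable_fun [set: R] (horner p) by exact: measurable_poly.
have mean p : poly_mean mu p = \sum_(x <- s) gauss_weight c n.+1 x * p.[x].
  exact: (muf _ (mp p)).2.
exists mu; split=> // [p|i j ni nj]; first exact: (muf _ (mp p)).1.
rewrite mean -(gauss_orthogonal c_gt0 ps)//.
by apply: eq_bigr => x _; rewrite hornerM.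
Qed.

Lemma gap0_gauss n (s : seq R) (mu : distr R) :
  (forall A, mu A = (\sum_(x <- s | x \in A) gauss_weight c n x)%:E) ->
  odd n -> opoly c n = \prod_(x <- s) ('X - x%:P) ->
  gap0 mu = (gauss_weight c n 0 / 2)%:E.
Proof.
move=> muA on ps; rewrite /gap0 std_normal_cdf0.
rewrite /dcdf /cdf /distribution /pushforward.
rewrite -[X in (X - _)%E]/(mu `]-oo, 0%R]%classic) muA.
rewrite (eq_bigl (fun x => x <= 0)); last first.
  by move=> x; apply/idP/idP; rewrite inE /= in_itv.
rewrite sum_gauss_weight_nonpos// -EFinB/=; congr EFin.
rewrite mulrDl mul1r addrC addKr ger0_norm// divr_ge0//.
by case: n on ps {muA} => // n _ _; rewrite ltW// gauss_weight_gt0.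
Qed.

End GaussDistribution.

(** The polynomials [opoly (normal_coef R) n] are the monic Hermite polynomials. *)
Definition normal_coef (R : realType) : nat -> R :=
  recurrence_coef (poly_mean (std_normal R)).

Section NormalRecurrence.

Variable R : realType.
Local Notation Z := (std_normal R).
Local Notation L := (poly_mean Z).
Local Notation b := (normal_coef R).

Let L_lin a p q : L (a *: p + q) = a * L p + L q.
Proof. by apply: poly_mean_linear; exact: integrable_std_normal_horner. Qed.

Lemma normal_coef_gt0 i : 0 < b i.
Proof. by apply: recurrence_coef_gt0 => p; exact: poly_mean_std_normal_sqr_gt0. Qed.

Lemma normal_op_orthogonal i j : L (opoly b i * opoly b j) = (i == j)%:R * opnorm b i.
Proof.
apply: opoly_orthogonal => //.
- exact: poly_mean1.
- exact: poly_mean_std_normal_sqr_gt0.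
- exact: poly_mean_std_normal_sym.
Qed.

(** Coefficients that agree below [d] give the same polynomials and norms up to index [d]. Both
    means then agree on products of two such polynomials, and [functional_eq0] covers all degrees up
    to [2d]. *)
Lemma gauss_matches_moments (c : nat -> R) d (mu : distr R) :
  (forall p : {poly R},
     mu.-integrable [set: measurableTypeR R] (fun x : R => p.[x]%:E)) ->
  (forall i j, (i <= d)%N -> (j <= d)%N ->
     poly_mean mu (opoly c i * opoly c j) = (i == j)%:R * opnorm c i) ->
  (forall i, (i < d)%N -> c i = b i) ->
  matches_moments d mu.
Proof.
move=> imu omu cb; apply: matches_momentsP => // p sp.
have copn i : (i <= d)%N -> opnorm c i = opnorm b i.
  by move=> id; apply: opnorm_eq => j ji; apply: cb; exact: leq_trans ji id.
have cop i : (i <= d)%N -> opoly c i = opoly b i.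
  move=> id; apply: opoly_eq => j ji; apply: cb.
  by rewrite (leq_trans (ltnW ji)).
apply/eqP; rewrite -subr_eq0; apply/eqP.
apply: (@functional_eq0 R b (fun q => poly_mean mu q - L q) d) => //.
  move=> a q r; rewrite L_lin poly_mean_linear//; ring.
move=> i j id jd.
by rewrite normal_op_orthogonal -(cop i)// -(cop j)// omu// copn// subrr.
Qed.

(** The nodes are the roots of [opoly b n]. The Gauss rule on them is exact for the degree of [P],
    so the normal mean of [P] is the total weight of the nonpositive nodes. *)
Lemma markov_stieltjes_normal n : odd n -> exists P : {poly R},
  [/\ (size P <= n.-1.*2.+1)%N, L P = (1 + gauss_weight b n 0) / 2,
      forall x : R, (x <= 0)%R%:R <= P.[x] &
      (1 < n)%N -> forall x : R, P.[x] = (x <= 0)%R%:R -> root (opoly b n) x].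
Proof.
move=> on; have n0 : (0 < n)%N by case: n on.
have [s [sn /lt_sorted_uniq us ps]] := opoly_sorted_roots normal_coef_gt0 n.
have rs x : (x \in s) = root (opoly b n) x by rewrite ps root_prod_XsubC.
have s0 : 0 \in s by rewrite rs opoly_odd_root0.
have mean (P : {poly R}) : (size P <= n.-1.*2.+1)%N ->
    (forall x, x \in s -> P.[x] = (x <= 0)%R%:R) ->
    L P = (1 + gauss_weight b n 0) / 2.
  move=> sP Ps; rewrite -(sum_gauss_weight_nonpos normal_coef_gt0 on ps).
  have ps' : opoly b n.-1.+1 = \prod_(x <- s) ('X - x%:P) by rewrite prednK.
  have [mu [_ imu mean omu]] := gauss_distr normal_coef_gt0 ps'.
  rewrite -(matches_poly_mean (gauss_matches_moments imu omu _) sP)// mean.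
  rewrite [RHS]big_mkcond big_seq [RHS]big_seq prednK//.
  by apply: eq_bigr => x /Ps ->; case: ifP => _; rewrite ?mulr1 ?mulr0.
pose s1 := [seq x <- s | x < 0]; pose s2 := [seq x <- s | 0 < x].
have s12 : (size s1 + size s2 = n.-1)%N.
  apply/eqP; rewrite -eqSS prednK// -sn -addn1.
  have -> : 1%N = count_mem 0 s by rewrite count_uniq_mem// s0.
  rewrite !size_filter -!sum1_count -sum1_size.
  rewrite [X in (X + _ + _)%N]big_mkcond [X in (_ + X + _)%N]big_mkcond.
  rewrite [X in (_ + X)%N]big_mkcond -!big_split/=.
  by apply/eqP/eq_bigr => x _; case: ltgtP.
(* Without positive nodes there are no negative ones, by symmetry; then [n = 1] and the constant 1
   serves as [P]. *)
have [s20|s2_neq0] := eqVneq s2 [::].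
  have s10 : s1 = [::].
    apply/eqP; rewrite -(negbK (s1 == _)); apply/negP => s1_neq0.
    have : head 0 s1 \in s1 by case: (s1) s1_neq0 => // y t _; rewrite mem_head.
    rewrite mem_filter => /andP[y0 ys].
    have : - head 0 s1 \in s2 by rewrite mem_filter oppr_gt0 y0 rs opoly_rootN -rs.
    by rewrite s20.
  have n1 : n = 1%N by rewrite -(prednK n0) -s12 s10 s20.
  exists 1; split.
  - by rewrite size_poly1.
  - apply: mean => [|x]; first by rewrite size_poly1.
    by rewrite rs n1 /opoly /= => /rootP; rewrite hornerX hornerC => ->; rewrite lexx.
  - by move=> x; rewrite hornerC; case: (x <= 0)%R; rewrite ?ler01.
  - by rewrite n1.
have [||||P] := markov_stieltjes (s1 := s1) (s2 := s2) _ _ _ _ s2_neq0.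
- exact: filter_uniq.
- exact: filter_uniq.
- by move=> z; rewrite mem_filter => /andP[].
- by move=> z; rewrite mem_filter => /andP[].
rewrite s12 => -[sP P1 P0].
have Px x : (x <= 0)%R%:R <= P.[x] ?= iff (x \in s).
  have [x0|x0] := leP x 0.
    have [h1 h2] := P1 x x0; split=> //; rewrite h2 inE mem_filter.
    by move: x0; rewrite le_eqVlt => /predU1P[->|x0]; rewrite ?eqxx ?s0// x0 lt_eqF.
  have [h1 h2] := P0 x x0; split=> //.
  by rewrite h2 mem_filter x0.
exists P; split=> //.
- by apply: mean => // x xs; apply/esym/eqP; rewrite (Px x).2.
- by move=> x; exact: (Px x).1.
- by move=> _ x /esym/eqP; rewrite (Px x).2 rs.
Qed.

Section GapBound.

Variables (n : nat) (nu : distr R).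
Hypotheses (on : odd n) (mnu : matches_moments n.-1 nu).

Let l := gauss_weight b n 0.

Let A : set (measurableTypeR R) := `]-oo, 0%R]%classic.
Let B : set (measurableTypeR R) := `[0%R, +oo[%classic.

Let mA : measurable A. Proof. exact: measurable_itv. Qed.
Let mB : measurable B. Proof. exact: measurable_itv. Qed.

Let indicA (x : R) : \1_A x = (x <= 0)%R%:R :> R.
Proof. by rewrite indicE /A mem_setE in_itv. Qed.

Let indicB (x : R) : \1_B x = (- x <= 0)%R%:R :> R.
Proof. by rewrite indicE /B mem_setE in_itv/= andbT oppr_le0. Qed.

(** The two half-lines cover the line, so an upper bound for [nu B] is a lower bound for [nu A]. *)
Let AB1 : 1 <= fine (nu A) + fine (nu B).
Proof.
rewrite -lee_fin EFinD !fineK ?fin_num_measure//.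
rewrite -[leLHS](distr_setT nu); apply: (le_trans _ (measureU2 _ _ _)) => //.
apply: le_measure; rewrite ?inE//; first exact: measurableU.
move=> x _; have [x0|x0] := leP x 0; [left|right]; rewrite /A /B /= in_itv//=.
by rewrite (ltW x0).
Qed.

Let gapE : gap0 nu = `|fine (nu A) - 2^-1|%:E.
Proof.
rewrite /gap0 std_normal_cdf0 /dcdf /cdf /distribution /pushforward.
by rewrite -[X in (X - _)%E]/(nu A) -[nu A]fineK ?fin_num_measure.
Qed.

Let sizeN (P : {poly R}) : size (P \Po - 'X) = size P.
Proof. by rewrite size_comp_poly2// size_polyN size_polyX. Qed.

Let hornerN (P : {poly R}) x : (P \Po - 'X).[x] = P.[- x].
Proof. by rewrite horner_comp hornerN hornerX. Qed.

Let bounds : exists P : {poly R},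
  [/\ poly_mean nu P = (1 + l) / 2, poly_mean nu (P \Po - 'X) = (1 + l) / 2,
      fine (nu A) <= (1 + l) / 2, fine (nu B) <= (1 + l) / 2 &
      [/\ nu.-integrable [set: measurableTypeR R] (fun x : R => P.[x]%:E),
      nu.-integrable [set: measurableTypeR R] (fun x : R => (P \Po - 'X).[x]%:E),
      forall x, \1_A x <= P.[x], forall x, \1_B x <= (P \Po - 'X).[x] &
      (1 < n)%N -> forall x : R, P.[x] = (x <= 0)%R%:R -> root (opoly b n) x]].
Proof.
have [P [sP LP P1 Pn]] := markov_stieltjes_normal on.
have sPN : (size (P \Po - 'X) <= n.-1.*2.+1)%N by rewrite sizeN.
have iP := matches_integrable mnu sP.
have iPN := matches_integrable mnu sPN.
have PA x : \1_A x <= P.[x] by rewrite indicA.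
have PB x : \1_B x <= (P \Po - 'X).[x] by rewrite indicB hornerN.
have mP : poly_mean nu P = (1 + l) / 2 by rewrite (matches_poly_mean mnu sP).
have mPN : poly_mean nu (P \Po - 'X) = (1 + l) / 2.
  by rewrite (matches_poly_mean mnu sPN) poly_mean_std_normal_sym.
exists P; split=> //; [rewrite -mP|rewrite -mPN];
  exact: indic_le_poly_mean.
Qed.

Lemma gap0_le : (gap0 nu <= (l / 2)%:E)%E.
Proof.
have [P [_ _ FA FB _]] := bounds; rewrite gapE lee_fin ler_norml.
by have := AB1; move: FA FB; lra.
Qed.

Hypothesis mnu' : matches_moments n nu.

(** The additional even moment fixes the mean of [opoly b n ^+ 2], of degree [2n], at its positive
    normal value; attaining the bound would make this mean 0. *)
Lemma gap0_lt : (gap0 nu < (l / 2)%:E)%E.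
Proof.
have n0 : (0 < n)%N by case: (n) on.
rewrite lt_neqAle gap0_le andbT; apply/negP => /eqP gap_eq.
have [P [mP mPN FA FB [iP iPN PA PB Pn]]] := bounds.
(* If [nu A] exceeds one half by [l / 2], its bound is attained; if it falls short by [l / 2], [AB1]
   forces equality for [B]. *)
have cases : fine (nu A) = (1 + l) / 2 \/ fine (nu B) = (1 + l) / 2.
  move: gap_eq; rewrite gapE => -[].
  case: ger0P => _ e; [left|right].
    by move: e; lra.
  by apply/eqP; rewrite eq_le FB /=; have := AB1; move: e; lra.
pose q := opoly b n ^+ 2.
have : 0 < poly_mean nu q.
  rewrite (matches_poly_mean mnu').
    by apply: poly_mean_std_normal_sqr_gt0; rewrite monic_neq0// opoly_monic.
  rewrite /q expr2 size_monicM ?opoly_monic ?monic_neq0 ?opoly_monic// !size_opoly.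
  by rewrite addSn addnS addnn.
suff -> : poly_mean nu q = 0 by rewrite ltxx.
have qroot x : root (opoly b n) x -> q.[x] = 0.
  by move=> /rootP rx; rewrite /q horner_exp rx expr0n.
(* For [n = 1] the polynomial [P] is the constant 1 and has no information on the
   support; instead, [X] has constant sign and mean zero. *)
have [n1|n_neq1] := eqVneq n 1%N.
  have l1 : (1 + l) / 2 = 1.
    rewrite /l n1 /gauss_weight big_ord1 /opoly /= hornerC opnorm0 expr1n divr1 invr1.
    by rewrite -mulr2n -[_ *+ 2]mulr_natr mul1r divff.
  have sX a : (size (a *: 'X : {poly R}) <= n.*2.+1)%N.
    by rewrite (leq_trans (size_scale_leq _ _))// size_polyX n1.
  have mX a : poly_mean nu (a *: 'X) = 0.
    (* ['X * 1] is [opoly b 1 * opoly b 0], whose normal mean is 0 by orthogonality. *)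
    rewrite (matches_poly_mean mnu' (sX a)) -['X]mulr1.
    have := L_lin a ('X * 1) 0; rewrite addr0 => ->.
    have := normal_op_orthogonal 1 0; rewrite mul0r => ->.
    rewrite mulr0 add0r; have := L_lin 1 0 0.
    by rewrite scaler0 addr0 mul1r => /eqP; rewrite -subr_eq subrr eq_sym => /eqP.
  have iX a := matches_integrable mnu' (sX a).
  have qX a x : a != 0 -> (a *: 'X).[x] = 0 -> q.[x] = 0.
    move=> a0; rewrite hornerZ hornerX => /eqP; rewrite mulf_eq0 (negPf a0)/=.
    by move=> /eqP ->; apply: qroot; rewrite n1; apply/rootP; rewrite hornerX.
  case: cases; rewrite l1 => e.
    apply: (poly_mean_eq0_on mA (iX (-1))) => //; last first.
    - by move=> x; apply: qX; rewrite oppr_eq0 oner_eq0.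
    - move=> x; rewrite /A /= in_itv/= => x0.
      by rewrite hornerZ hornerX mulN1r oppr_ge0.
    - by rewrite -[LHS]fineK ?fin_num_measure// e.
  apply: (poly_mean_eq0_on mB (iX 1)) => //; last first.
  - by move=> x; apply: qX; rewrite oner_eq0.
  - by move=> x; rewrite /B /= in_itv/= andbT hornerZ hornerX mul1r.
  - by rewrite -[LHS]fineK ?fin_num_measure// e.
have n_gt1 : (1 < n)%N by rewrite ltn_neqAle eq_sym n_neq1.
case: cases => [eA|eB].
  apply: (indic_eq_poly_mean mA iP PA); first by rewrite eA.
  by move=> x; rewrite indicA => /(Pn n_gt1) /qroot.
apply: (indic_eq_poly_mean mB iPN PB); first by rewrite eB.
by move=> x; rewrite indicB hornerN => /(Pn n_gt1); rewrite opoly_rootN => /qroot.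
Qed.

End GapBound.

End NormalRecurrence.

(** * Near-optimal mixtures *)

Section GaussMixture.

Variables (R : realType) (c : nat -> R) (n : nat) (s : seq R) (mu : distr R).
Hypothesis c_gt0 : forall i, 0 < c i.
Hypothesis on : odd n.
Hypothesis sorted_s : sorted <%R s.
Hypothesis ps : opoly c n = \prod_(x <- s) ('X - x%:P).
Hypothesis muA :
  forall A, mu A = (\sum_(x <- s | x \in A) gauss_weight c n x)%:E.

(** The positive node [x0] makes the sorted list [t] of positive nodes nonempty, and the last entry
    of [t] is at least [x0]. Nodes and weights are symmetric. *)
Lemma gauss_discrete_mixture x0 : 0 < x0 -> x0 \in s ->
  exists2 ymax, discrete_mixture mu ymax & x0 <= ymax.
Proof.
move=> x00 x0s; have us := lt_sorted_uniq sorted_s.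
have rs x : (x \in s) = root (opoly c n) x by rewrite ps root_prod_XsubC.
pose t := [seq x <- s | 0 < x].
have st : sorted <%R t by apply: sorted_filter => //; exact: lt_trans.
have x0t : x0 \in t by rewrite mem_filter x00.
have tn : size t = (size t).-1.+1 by rewrite prednK//; case: (t) x0t.
pose y (i : 'I_(size t).-1.+1) := nth 0 t i.
have lt_t (i : 'I_(size t).-1.+1) : (i < size t)%N.
  exact: leq_trans (ltn_ord i) (eq_leq (esym tn)).
have yt i : y i \in t by rewrite mem_nth.
have mu1 x : x \in s -> mu [set x] = (gauss_weight c n x)%:E.
  move=> xs; rewrite muA (eq_bigl (pred1 x)); last first.
    by move=> z /=; apply/idP/eqP; rewrite inE.
  by rewrite -big_filter filter_pred1_uniq// big_seq1.
have w_gt0 x : 0 < gauss_weight c n x.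
  by case: n on => // m _; exact: gauss_weight_gt0.
have yp i : 0 < y i by have := yt i; rewrite mem_filter => /andP[].
have ys i : y i \in s by have := yt i; rewrite mem_filter => /andP[].
have yNs i : - y i \in s by rewrite rs opoly_rootN -rs.
have muy i : mu [set - y i] = mu [set y i] by rewrite !mu1// gauss_weightN.
exists (y ord_max).
  exists (size t).-1, y; split=> //.
  - by move=> i j ij; apply: (sorted_ltn_nth lt_trans) => //; rewrite inE.
  - by move=> i; split; rewrite ?muy// mu1// lte_fin.
  - have s0 : 0 \in s by rewrite rs opoly_odd_root0.
    under eq_bigr do rewrite muy mu1// -EFinD.
    rewrite sumEFin -EFinB mu1//; congr EFin.
    have -> : \sum_(i < (size t).-1.+1)
        (gauss_weight c n (y i) + gauss_weight c n (y i)) =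
        2 * \sum_(x <- s | 0 < x) gauss_weight c n x.
      rewrite -[in RHS]big_filter -/t.
      transitivity (2 * \sum_(0 <= i < (size t).-1.+1) gauss_weight c n t`_i).
        by rewrite big_mkord mulr_sumr; apply: eq_bigr => i _; rewrite mulrDl mul1r.
      by rewrite -tn [in RHS](big_nth 0).
    (* With [w] the weight of 0, the nonpositive nodes carry [(1 + w) / 2] of the total weight 1, so
       twice the positive part is [1 - w]. *)
    have := sum_gauss_weight_nonpos c_gt0 on ps.
    have : \sum_(x <- s) gauss_weight c n x = 1.
      by case: n on ps => // m _; exact: sum_gauss_weight.
    rewrite (bigID (fun x => x <= 0))/=.
    rewrite (eq_bigl (fun x => 0 < x) _ (P1 := fun x => ~~ (x <= 0))); last first.
      by move=> x; rewrite -ltNge.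
    by move=> + e; rewrite e; lra.
have /(nthP 0)[i it <-] := x0t.
have [->|im] := eqVneq i (size t).-1; first by [].
apply: ltW; apply: (sorted_ltn_nth lt_trans) => //=; first by rewrite inE tn.
by rewrite ltn_neqAle im -ltnS -tn.
Qed.

End GaussMixture.

Lemma opoly_gt0_above (R : rcfType) (c : nat -> R) n (M : R) : (forall i, 0 < c i) ->
  exists2 x, M <= x & 0 < (opoly c n).[x].
Proof.
move=> c_gt0; have [s [_ ps]] := opoly_real_roots c_gt0 n.
(* This point lies above every root, so all linear factors are positive there. *)
exists (`|M| + 1 + \sum_(y <- s) `|y|).
  by rewrite -addrA (le_trans (ler_norm M))// lerDl addr_ge0// sumr_ge0.
rewrite ps horner_prod big_seq; apply: prodr_gt0 => x xs.
rewrite hornerXsubC subr_gt0 (le_lt_trans (ler_norm x))//.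
rewrite (perm_big _ (perm_to_rem xs)) big_cons/= addrCA ltrDl.
by rewrite ltr_pwDl// ?sumr_ge0// ltr_wpDl.
Qed.

Section Approximation.

Variables (R : realType) (k : nat).
Hypothesis k_odd : odd k.
Local Notation b := (normal_coef R).
Local Notation l := (gauss_weight b k 0).

Lemma near_optimal_mixture (M e : R) : 0 < e ->
  exists (F : distr R) (ymax g : R),
    [/\ matches_moments k F, discrete_mixture F ymax, M <= ymax,
        gap0 F = g%:E & l / 2 - e < g].
Proof.
move=> e0; have b_gt0 := @normal_coef_gt0 R.
have [x Mx px] := opoly_gt0_above k `|M| b_gt0.
have x0 : 0 <= x := le_trans (normr_ge0 M) Mx.
pose S := \sum_(j < k) (opoly b j).[0] ^+ 2 / opnorm b j.
have S0 : 0 < S by rewrite /S; case: k k_odd => // m _; exact: opoly_kernel_gt0.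
pose a := (opoly b k.+1).[0] ^+ 2 / opnorm b k.
have a0 : 0 <= a by rewrite divr_ge0 ?sqr_ge0// ltW// opnorm_gt0.
(* The second summand makes the mass at 0 close to [l]; the third makes
   [opoly c k.+2] negative at [x], so that it has a root above [x]. *)
pose B := 1 + a / (2 * e * S ^+ 2) + `|x * (opoly b k.+1).[x] / (opoly b k).[x]|.
have aB : a / B < 2 * e * S ^+ 2.
  have d0 : 0 < 2 * e * S ^+ 2 by rewrite !mulr_gt0// exprn_gt0.
  have B0 : 0 < B by rewrite /B -addrA ltr_pwDl// addr_ge0// divr_ge0// ltW.
  rewrite ltr_pdivrMr// mulrC -ltr_pdivrMr// /B -addrA addrCA ltrDl.
  by rewrite ltr_pwDl.
have B0 : 0 < B.
  by rewrite /B -addrA ltr_pwDl// addr_ge0// divr_ge0// ltW// !mulr_gt0// exprn_gt0.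
pose c i := if i == k then B else b i.
have c_gt0 i : 0 < c i by rewrite /c; case: ifP.
have cb i : (i < k)%N -> c i = b i by rewrite /c ltn_neqAle => /andP[/negPf->].
have opcb i : (i <= k.+1)%N -> opoly c i = opoly b i.
  by move=> ik; apply: opoly_eq => j ji; apply: cb; rewrite -ltnS (leq_trans ji).
have opncb i : (i <= k)%N -> opnorm c i = opnorm b i.
  by move=> ik; apply: opnorm_eq => j ji; apply: cb; exact: leq_trans ik.
have [s [sn ss ps]] := opoly_sorted_roots c_gt0 k.+2.
have [F [FA iF _ oF]] := gauss_distr c_gt0 ps.
have [y ys xy] : exists2 y, y \in s & x < y.
  apply: contrapT => H.
  have : 0 <= (opoly c k.+2).[x].
    rewrite ps horner_prod big_seq; apply: prodr_ge0 => y ys.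
    rewrite hornerXsubC subr_ge0 leNgt; apply/negP => xy.
    by apply: H; exists y.
  rewrite horner_opolySS /c eqxx -/c opcb// opcb// subr_ge0 leNgt => /negP; apply.
  rewrite -ltr_pdivrMr//; apply: (le_lt_trans (ler_norm _)).
  rewrite /B ltrDr ltr_pwDl// divr_ge0// ltW// !mulr_gt0// exprn_gt0//.
have ok2 : odd k.+2 by rewrite /= negbK.
have [ymax Fy yy] := gauss_discrete_mixture c_gt0 ok2 ss ps FA (le_lt_trans x0 xy) ys.
exists F, ymax, (gauss_weight c k.+2 0 / 2); split=> //.
(* The rule is orthogonal for [c] up to index [k + 1], but [cb] gives agreement with [b] below [k],
   whence [d = k]. *)
- apply: (gauss_matches_moments iF _ cb) => i j ik jk.
  by apply: oF; rewrite (leq_trans _ (leqnSn k)).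
- by rewrite (le_trans (ler_norm M))// (le_trans Mx)// (le_trans (ltW xy)).
- exact: gap0_gauss FA ok2 ps.
(* Of the two terms beyond [S], the one of index [k] is 0 because [k] is odd, and the one of index
   [k + 1] is [a / B] because [B] is the last factor of its norm. *)
have wE : gauss_weight c k.+2 0 = (S + a / B)^-1.
  congr _^-1; rewrite !big_ord_recr/= !opcb// opncb// opnormS opncb//.
  rewrite (rootP (opoly_odd_root0 b k_odd)) expr0n mul0r addr0 /c eqxx invfM mulrA.
  congr (_ + _); apply: eq_bigr => j _.
  by rewrite opcb ?opncb// ltnW// ltnS ltnW.
rewrite wE -/S; have t0 : 0 <= a / B by rewrite divr_ge0// ltW.
(* The weight falls short of [l] by [t / (S * (S + t))], at most [t / S ^+ 2], which is below
   [2 * e] by the choice of [B]. *)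
move: (a / B) t0 aB => t t0 tS.
have -> : l = S^-1 by [].
rewrite -subr_gt0.
have -> : (S + t)^-1 / 2 - (S^-1 / 2 - e) =
    (2 * e * S * (S + t) - t) / (2 * S * (S + t)).
  by field; rewrite !gt_eqF//= ltr_pwDl.
have St : 0 < S + t by rewrite ltr_pwDl.
apply: divr_gt0; last by rewrite !mulr_gt0.
by rewrite subr_gt0 (lt_le_trans tS)// expr2 !mulrA ler_pM2l ?mulr_gt0// lerDl.
Qed.

End Approximation.

(** * Supremum, extremal distribution and limit *)

Lemma matches_moments_leq (R : realType) k j (mu : distr R) :
  (j <= k)%N -> matches_moments k mu -> matches_moments j mu.
Proof.
move=> jk mk i /andP[i1 ij]; apply: mk; rewrite i1/=.
by rewrite (leq_trans ij)// leq_double.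
Qed.

Theorem theorem4 (R : realType) (k : nat) (k_ge1 : (1 <= k)%N) (k_odd : odd k) :
  [/\ ~ (exists mu : distr R, matches_moments k mu /\
           forall nu : distr R, matches_moments k nu -> (gap0 nu <= gap0 mu)%E),
      exists mu0 : distr R,
        [/\ matches_moments k.-1 mu0,
            forall nu : distr R, matches_moments k.-1 nu -> (gap0 nu <= gap0 mu0)%E
          & ereal_sup [set gap0 nu | nu in [set nu : distr R | matches_moments k nu]]
            = gap0 mu0]
    & exists (F : nat -> distr R) (ymax : nat -> R),
        [/\ forall m, matches_moments k (F m),
            forall m, discrete_mixture (F m) (ymax m),
            ymax m @[m --> \oo] --> +oo
          & gap0 (F m) @[m --> \oo] -->
            ereal_sup [set gap0 nu | nu in [set nu : distr R | matches_moments k nu]]]].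
Proof.
pose l := gauss_weight (normal_coef R) k 0.
have le_gap nu : matches_moments k.-1 nu -> (gap0 nu <= (l / 2)%:E)%E.
  exact: gap0_le.
have sup_gap : ereal_sup
    [set gap0 nu | nu in [set nu : distr R | matches_moments k nu]] = (l / 2)%:E.
  apply/eqP; rewrite eq_le; apply/andP; split.
    apply: ge_ereal_sup => _ [nu mnu <-].
    by apply: le_gap; exact: matches_moments_leq (leq_pred k) mnu.
  apply/lee_subgt0Pr => e e0.
  have [F [_ [g [mF _ _ gF lg]]]] := near_optimal_mixture k_odd 0 e0.
  apply: (@le_trans _ _ (gap0 F)).
    by rewrite gF -EFinB lee_fin ltW.
  by apply: ereal_sup_ubound; exists F.
rewrite sup_gap; split.
- move=> [mu [mmu max_mu]].
  (* A maximizer would have gap at least the supremum [l / 2], against the strict bound. *)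
  have := gap0_lt k_odd (matches_moments_leq (leq_pred k) mmu) mmu.
  rewrite ltNge => /negP; apply; rewrite -/l -sup_gap.
  by apply: ge_ereal_sup => _ [nu mnu <-]; exact: max_mu.
(* The extremal distribution for [k - 1] even moments is the [k]-point Gauss rule. *)
- have [s [_ _ ps]] := opoly_sorted_roots (@normal_coef_gt0 R) k.
  have ps' : opoly (normal_coef R) k.-1.+1 = \prod_(x <- s) ('X - x%:P).
    by rewrite prednK.
  have [mu0 [mu0A imu0 _ omu0]] := gauss_distr (@normal_coef_gt0 R) ps'.
  have gap_mu0 : gap0 mu0 = (l / 2)%:E.
    apply: (gap0_gauss (@normal_coef_gt0 R) _ k_odd ps) => A.
    by rewrite mu0A prednK.
  exists mu0; rewrite gap_mu0; split=> //.
  exact: gauss_matches_moments imu0 omu0 _.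
- have pos m : 0 < m.+1%:R^-1 :> R by rewrite invr_gt0.
  (* The triple holds the mixture, its maximal mass point and its gap, for [M = m] and
     [e = 1 / (m + 1)]; the gaps are then squeezed towards [l / 2]. *)
  pose P m (t : distr R * R * R) := [/\ matches_moments k t.1.1,
    discrete_mixture t.1.1 t.1.2, m%:R <= t.1.2, gap0 t.1.1 = t.2%:E &
    l / 2 - m.+1%:R^-1 < t.2].
  have /choice[t Pt] : forall m, exists t, P m t.
    move=> m; have [F [ymax [g H]]] := near_optimal_mixture k_odd m%:R (pos m).
    by exists (F, ymax, g).
  exists (fun m => (t m).1.1), (fun m => (t m).1.2); split.
  + by move=> m; case: (Pt m).
  + by move=> m; case: (Pt m).
  + apply: (ger_cvgy _ (@cvgr_idn R)).
    by apply: nearW => m; case: (Pt m).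
  have -> : (fun m => gap0 (t m).1.1) = EFin \o (fun m => (t m).2).
    by apply/funext => m /=; case: (Pt m).
  apply: cvg_EFin; first by apply: nearW.
  apply: (@squeeze_cvgr _ _ _ _ (fun m => l / 2 - m.+1%:R^-1) (cst (l / 2))).
  + apply: nearW => m; case: (Pt m) => mF _ _ gF /ltW -> /=.
    by rewrite -lee_fin -gF le_gap//; exact: matches_moments_leq (leq_pred k) mF.
  + rewrite -[X in _ --> X]subr0; apply: cvgB; first exact: cvg_cst.
    exact: cvg_harmonic.
  + exact: cvg_cst.
Qed.
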